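(* Let $\Omega\subset\mathbb R^n$ be a bounded domain satisfying the uniform exterior ball condition. Assume $0<\sigma<2$, $b_{ab}\equiv0$ in $\Omega$ if $\sigma<1$, and $c_{ab}\ge\gamma$ in $\Omega$ for all $a\in\mathcal A,b\in\mathcal B$, for some $\gamma>0$. Let $g$ be a bounded continuous function in $\mathbb R^n$. Assume that $b_{ab}:\Omega\to\mathbb R^n$, $c_{ab},f_{ab}:\Omega\to\mathbb R$ are bounded and uniformly continuous on $\Omega$, with bound and modulus of continuity uniform in $a,b$; that $x\mapsto K_{ab}(x,z)$ is uniformly continuous on $\Omega$ with a modulus uniform in $a,b$ and $z\neq0$, and for each $z\neq 0$ bounded uniformly in $x,a,b$; and that $\{K_{ab}(x,\cdot):x\in\Omega,a\in\mathcal A,b\in\mathcal B\}$ are kernels with the upper-bound conditions (common constant $\Lambda$) and the boundary nondegeneracy condition of the context. Then the Dirichlet problem $$\sup_{a\in\mathcal A}\inf_{b\in\mathcal B}\{-I_{ab}[x,u]+b_{ab}(x)\cdot\nabla u(x)+c_{ab}(x)u(x)+f_{ab}(x)\}=0\ \text{ in }\Omega,\qquad u=g\ \text{ in }\Omega^c$$ admits a continuous viscosity supersolution $\bar u$ and a continuous viscosity subsolution $\underline u$ with $\bar u=\underline u=g$ in $\Omega^c$.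
   Context: $B_\delta(x)$ is the open ball, $B_\delta=B_\delta(0)$; $\mathcal A,\mathcal B$ are index sets. $C_b^2(\mathbb R^n)$ is the set of bounded functions on $\mathbb R^n$ with locally Lipschitz first partial derivatives (convention $C^2=C^{1,1}$). Uniform exterior ball condition: there is $r_\Omega\in(0,1)$ such that for any $x\in\partial\Omega$ and $0<r\le r_\Omega$ there is a point $y_x^r\in\Omega^c$ (fixed once and for all) with $\bar B_r(y_x^r)\cap\bar\Omega=\{x\}$. Operators: $I_{ab}[x,u]=\int_{\mathbb R^n}\delta_zu(x)K_{ab}(x,z)\,dz$, where $\delta_zu(x)$ equals $u(x+z)-u(x)$ if $\sigma<1$; $u(x+z)-u(x)-\mathbf 1_{B_1}(z)\nabla u(x)\cdot z$ if $\sigma=1$; $u(x+z)-u(x)-\nabla u(x)\cdot z$ if $\sigma>1$. Upper-bound conditions on a (measurable) kernel $K$: $K\ge0$ and for every $\delta>0$, $\int_{B_{2\delta}\setminus B_\delta}K(z)\,dz\le(2-\sigma)\Lambda\delta^{-\sigma}$ and $|\int_{B_{2\delta}\setminus B_\delta}zK(z)\,dz|\le\Lambda|1-\sigma|\delta^{1-\sigma}$. Boundary nondegeneracy condition: there exist $C_4>0$, $0<r_1<r_\Omega$, $\lambda>0$, $\mu>0$ such that for any $x\in\partial\Omega$, $0<r<r_1$, $y\in\Omega\cap B_{2r}(y_x^r)$ and every kernel $K=K_{ab}$ of the family, setting $\nu_y=\frac{y-y_x^r}{|y-y_x^r|}$ and $s_y=\frac{|y-y_x^r|}{r}-1$, there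 is a set $A\subset\{z: z\cdot\nu_y<-rs_y\}\cap(B_{C_4rs_y}\setminus B_{rs_y})$ with $|A|\ge\mu|B_{rs_y}|$ and $K(y,z)\ge(2-\sigma)\lambda(rs_y)^{-n-\sigma}$ for all $z\in A$. Viscosity notions: write $F(x,r,\varphi)=\sup_a\inf_b\{-I_{ab}[x,\varphi]+b_{ab}(x)\cdot\nabla\varphi(x)+c_{ab}(x)r+f_{ab}(x)\}$. A bounded upper (lower) semicontinuous $u$ on $\mathbb R^n$ is a viscosity subsolution (supersolution) of the equation in $\Omega$ if whenever $u-\varphi$ has a maximum (minimum) over $\mathbb R^n$ at $x\in\Omega$ with $\varphi\in C_b^2(\mathbb R^n)$, then $F(x,u(x),\varphi)\le0$ ($\ge0$); of the Dirichlet problem if moreover $u\le g$ ($u\ge g$) in $\Omega^c$. *)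

(* Defs.v *)
From HB Require Import structures.
From mathcomp Require Import all_boot all_order all_algebra.
From mathcomp Require Import all_classical all_reals all_analysis.

Set Implicit Arguments.
Unset Strict Implicit.
Unset Printing Implicit Defensive.
Import Order.TTheory GRing.Theory Num.Theory.
Import numFieldNormedType.Exports.
Local Open Scope classical_set_scope.
Local Open Scope ring_scope.

Definition rV_display : measure_display.
Proof. exact. Qed.

(* The sigma-algebra generated by the coordinates, i.e. the Borel one. *)
Section borel_rV.
Context (R : realType) (n : nat).

Definition rV_coord (i : 'I_n) (v : 'rV[R]_n) : measurableTypeR R := v ord0 i.

Let rV_set0 : g_sigma_preimage rV_coord set0.
Proof. exact: sigma_algebra0. Qed.

Let rV_setC A :
  g_sigma_preimage rV_coord A -> g_sigma_preimage rV_coord (~` A).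
Proof. exact: sigma_algebraC. Qed.

Let rV_bigcup (F : _^nat) : (forall i, g_sigma_preimage rV_coord (F i)) ->
  g_sigma_preimage rV_coord (\bigcup_i (F i)).
Proof. exact: sigma_algebra_bigcup. Qed.

HB.instance Definition _ := @isMeasurable.Build rV_display
  'rV[R]_n (g_sigma_preimage rV_coord) rV_set0 rV_setC rV_bigcup.

Lemma measurable_rV_coord i : measurable_fun [set: 'rV[R]_n] (@rV_coord i).
Proof.
move=> _ Y mY; rewrite setTI; apply: sub_sigma_algebra => /=.
rewrite -bigcup_seq/=; exists i => /=; first by rewrite mem_index_enum.
by exists Y => //; rewrite setTI.
Qed.

Lemma measurable_fun_rV d (T : measurableType d) (f : T -> 'rV[R]_n) :
  (forall i, measurable_fun setT (@rV_coord i \o f)) -> measurable_fun setT f.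
Proof.
move=> mf.
have sub : g_sigma_preimage (fun i => @rV_coord i \o f) `<=` measurable.
  apply: smallest_sub; first exact: sigma_algebra_measurable.
  move=> A; rewrite -bigcup_seq => -[i _ [B mB <-]]; exact: mf.
by rewrite g_sigma_preimage_comp in sub => _ A mA; apply: sub; exists A.
Qed.

End borel_rV.

Section lebesgue_rV_succ.
Context (R : realType) (n : nat).
Variable m : {sigma_finite_measure set 'rV[R]_n -> \bar R}.

Definition rV_cons (p : measurableTypeR R * 'rV[R]_n) : 'rV[R]_(1 + n) :=
  row_mx (\row__ p.1) p.2.

Definition rV_uncons (v : 'rV[R]_(1 + n)) : measurableTypeR R * 'rV[R]_n :=
  (lsubmx v ord0 ord0, rsubmx v).

Lemma rV_uncons_K : cancel rV_uncons rV_cons.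
Proof.
move=> v; rewrite /rV_cons/= -[RHS]hsubmxK; congr row_mx.
by apply/rowP => i; rewrite mxE (ord1 i).
Qed.

Lemma rV_consK : cancel rV_cons rV_uncons.
Proof.
by case=> x v; rewrite /rV_uncons /rV_cons/= row_mxKl row_mxKr mxE.
Qed.

Lemma measurable_rV_cons : measurable_fun setT rV_cons.
Proof.
apply: measurable_fun_rV => i; rewrite -(splitK i).
case: (fintype.split i) => j /=.
  rewrite (_ : _ \o _ = fst); first exact: measurable_fst.
  by apply/funext => p; rewrite /rV_coord /= row_mxEl mxE.
rewrite (_ : _ \o _ = @rV_coord R n j \o snd).
  exact: measurableT_comp (measurable_rV_coord _) measurable_snd.
by apply/funext => p; rewrite /rV_coord /= row_mxEr.
Qed.

Lemma measurable_rV_uncons : measurable_fun setT rV_uncons.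
Proof.
apply: measurable_fun_pair.
  rewrite (_ : (fun _ => _) = @rV_coord R (1 + n) (lshift n ord0)).
    exact: measurable_rV_coord.
  by apply/funext => v; rewrite mxE.
apply: measurable_fun_rV => i.
rewrite (_ : _ \o _ = @rV_coord R (1 + n) (rshift 1 i)).
  exact: measurable_rV_coord.
by apply/funext => v; rewrite /rV_coord/= mxE.
Qed.

Definition lebesgue_rV_succ : set 'rV[R]_(1 + n) -> \bar R :=
  pushforward (@lebesgue_measure R \x m)%E rV_cons.

Let lebesgue_rV_succ0 : lebesgue_rV_succ set0 = 0%E.
Proof. by rewrite /lebesgue_rV_succ /pushforward preimage_set0 measure0. Qed.

Let lebesgue_rV_succ_ge0 A : (0 <= lebesgue_rV_succ A)%E.
Proof. by rewrite /lebesgue_rV_succ /pushforward; exact: measure_ge0. Qed.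

Let lebesgue_rV_succ_sigma_additive : semi_sigma_additive lebesgue_rV_succ.
Proof.
move=> F mF tF mUF; rewrite /lebesgue_rV_succ /pushforward preimage_bigcup.
have mpre A : measurable A -> measurable (rV_cons @^-1` A).
  by move=> mA; rewrite -[X in measurable X]setTI; exact: measurable_rV_cons.
apply: measure_semi_sigma_additive.
- by move=> k; exact: mpre.
- apply/trivIsetP => /= i j _ _ ij; rewrite -preimage_setI.
  by move/trivIsetP : tF => /(_ _ _ _ _ ij) ->//; rewrite preimage_set0.
- by rewrite -preimage_bigcup; exact: mpre.
Qed.

HB.instance Definition _ := isMeasure.Build _ _ _ lebesgue_rV_succ
  lebesgue_rV_succ0 lebesgue_rV_succ_ge0 lebesgue_rV_succ_sigma_additive.

Let lebesgue_rV_succ_sigma_finite : sigma_finite setT lebesgue_rV_succ.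
Proof.
have /sigma_finiteP[F [TF ndF Foo]] := sigma_finiteT (@lebesgue_measure R).
have /sigma_finiteP[G [TG ndG Goo]] := sigma_finiteT m.
exists (fun k => rV_uncons @^-1` (F k `*` G k)).
  apply/esym; rewrite -subTset => v _.
  have [i _ Fi] : (\bigcup_k F k) (rV_uncons v).1 by rewrite -TF.
  have [j _ Gj] : (\bigcup_k G k) (rV_uncons v).2 by rewrite -TG.
  exists (maxn i j) => //; split => /=.
    by move: Fi; exact/subsetPset/ndF/leq_maxl.
  by move: Gj; exact/subsetPset/ndG/leq_maxr.
move=> k; have [mF Fk] := Foo k; have [mG Gk] := Goo k; split.
  rewrite -[X in measurable X]setTI; apply: measurable_rV_uncons => //.
  exact: measurableX.
rewrite /lebesgue_rV_succ /pushforward -comp_preimage.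
rewrite (_ : _ \o _ = id); last by apply/funext => p /=; rewrite rV_consK.
by rewrite [ltLHS]product_measure1E// lte_mul_pinfty// ge0_fin_numE.
Qed.

HB.instance Definition _ := Measure_isSigmaFinite.Build _ _ _ lebesgue_rV_succ
  lebesgue_rV_succ_sigma_finite.

End lebesgue_rV_succ.

Section lebesgue_rV.
Context (R : realType).

Let dirac_rV0 : {sigma_finite_measure set 'rV[R]_0 -> \bar R} :=
  @dirac _ _ (0 : 'rV[R]_0) R.

(* The n-fold product of the Lebesgue measure of R, on Borel sets. *)
Fixpoint borel_lebesgue_rV (n : nat) :
    {sigma_finite_measure set 'rV[R]_n -> \bar R} :=
  if n is k.+1 then lebesgue_rV_succ (borel_lebesgue_rV k) else dirac_rV0.

(* Its completion: the measurable sets of [lebesgueT n] are the Lebesgue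
   measurable sets. [lebesgueT n] is convertible to ['rV[R]_n]. *)
Definition lebesgueT (n : nat) := caratheodory_type (mu_ext (borel_lebesgue_rV n)).

HB.instance Definition _ n := Measurable.on (lebesgueT n).

Definition lebesgue_rV (n : nat) : set (lebesgueT n) -> \bar R :=
  @completed_measure_extension _ _ _ (borel_lebesgue_rV n).

HB.instance Definition _ n := Measure.on (@lebesgue_rV n).

End lebesgue_rV.

(* The norm which the library puts on ['rV[R]_n] is the sup norm. It is used
   below only through the topology, the bounded sets and the Lipschitz functions
   that it defines; balls and moduli of continuity use [enorm]. *)
Section euclidean.
Context (R : realType) (n : nat).
Implicit Types (u v x y : 'rV[R]_n) (r : R) (A : set 'rV[R]_n).

Definition dotmul u v : R := \sum_i u ord0 i * v ord0 i.

Definition enorm v : R := Num.sqrt (dotmul v v).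

Definition eball x r : set 'rV[R]_n := [set y | enorm (y - x) < r].

Definition eclosed_ball x r : set 'rV[R]_n := [set y | enorm (y - x) <= r].

Definition boundary A : set 'rV[R]_n := closure A `\` A°.

Definition bounded_domain A : Prop :=
  [/\ open A, A !=set0, connected A & bounded_set A].

Definition grad (phi : 'rV[R]_n -> R) x : 'rV[R]_n :=
  \row_i 'D_(delta_mx ord0 i) phi x.

Definition Cb2 (phi : 'rV[R]_n -> R) : Prop :=
  [bounded phi x | x in [set: 'rV[R]_n]] /\
  forall i : 'I_n, (forall x, derivable phi x (delta_mx ord0 i)) /\
    forall x, exists2 U, nbhs x U &
      [lipschitz 'D_(delta_mx ord0 i) phi y | y in U].

Definition uniform_exterior_ball (Omega : set 'rV[R]_n) (rO : R)
    (yb : 'rV[R]_n -> R -> 'rV[R]_n) : Prop :=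
  0 < rO < 1 /\
  forall x r, boundary Omega x -> 0 < r <= rO ->
    ~ Omega (yb x r) /\ eclosed_ball (yb x r) r `&` closure Omega = [set x].

Section equi.
Context (I : Type) (V : zmodType) (Vnorm : V -> R).
Variables (Omega : set 'rV[R]_n) (h : I -> 'rV[R]_n -> V).

Definition equi_bounded : Prop :=
  exists M : R, forall i x, Omega x -> Vnorm (h i x) <= M.

Definition equi_unif_continuous : Prop :=
  forall e : R, 0 < e -> exists2 d : R, 0 < d &
    forall i x y, Omega x -> Omega y -> enorm (x - y) < d ->
      Vnorm (h i x - h i y) < e.

End equi.

End euclidean.

Section nonlocal.
Context (R : realType) (n : nat) (sigma : R).
Local Notation leb := (@lebesgue_rV R n).
Implicit Types (u phi : 'rV[R]_n -> R) (x y z : 'rV[R]_n).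

Definition kernel_upper_bounds (Lam : R) (K : 'rV[R]_n -> R) : Prop :=
  [/\ measurable_fun [set: lebesgueT R n] K,
      forall z, 0 <= K z &
      forall d : R, 0 < d ->
        let D := eball 0 (2 * d) `\` eball 0 d in
        (\int[leb]_(z in D) (K z)%:E
           <= ((2 - sigma) * Lam * d `^ (- sigma))%:E)%E /\
        enorm (\row_i \int[leb]_(z in D) (z ord0 i * K z))
          <= Lam * `|1 - sigma| * d `^ (1 - sigma)].

Definition delta u x z : R :=
  if sigma < 1 then u (x + z) - u x
  else if sigma == 1 then
    u (x + z) - u x - \1_(eball 0 1) z * dotmul (grad u x) z
  else u (x + z) - u x - dotmul (grad u x) z.

(* The integral converges absolutely if [u] is in [Cb2] and the kernel
   satisfies [kernel_upper_bounds]. *)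
Definition nonlocal_op (K : 'rV[R]_n -> 'rV[R]_n -> R) x u : R :=
  \int[leb]_z (delta u x z * K x z).

Section family.
Context (A B : Type).
Variable K : A -> B -> 'rV[R]_n -> 'rV[R]_n -> R.

Definition boundary_nondegenerate (Omega : set 'rV[R]_n) (rO : R)
    (yb : 'rV[R]_n -> R -> 'rV[R]_n) : Prop :=
  exists C4 r1 lam mu : R,
    [/\ 0 < C4, 0 < r1 < rO, 0 < lam, 0 < mu &
    forall x r y a b, boundary Omega x -> 0 < r < r1 -> Omega y ->
      eball (yb x r) (2 * r) y ->
      let nu := (enorm (y - yb x r))^-1 *: (y - yb x r) in
      let s := enorm (y - yb x r) / r - 1 in
      exists S : set (lebesgueT R n),
        [/\ measurable S,
            S `<=` [set z | dotmul z nu < - (r * s)]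
                     `&` (eball 0 (C4 * (r * s)) `\` eball 0 (r * s)),
            (mu%:E * leb (eball 0 (r * s)) <= leb S)%E &
            forall z, S z ->
              (2 - sigma) * lam * (r * s) `^ (- n%:R - sigma) <= K a b y z]].

(* The supremum and infimum are taken in [\bar R]; they are finite when the
   data are bounded uniformly in [a] and [b]. *)
Definition isaacs (bb : A -> B -> 'rV[R]_n -> 'rV[R]_n)
    (c f : A -> B -> 'rV[R]_n -> R) x (r : R) phi : \bar R :=
  ereal_sup [set ereal_inf
    [set (- nonlocal_op (K a b) x phi + dotmul (bb a b x) (grad phi x)
          + c a b x * r + f a b x)%:E | b in [set: B]] | a in [set: A]].

End family.

End nonlocal.

Section viscosity.
Context (R : realType) (n : nat).
Variables (Omega : set 'rV[R]_n).
Variable F : 'rV[R]_n -> R -> ('rV[R]_n -> R) -> \bar R.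
Implicit Types u g : 'rV[R]_n -> R.

Definition upper_semicontinuous u : Prop :=
  lower_semicontinuous (fun x => (- u x)%:E).

Definition viscosity_subsolution u : Prop :=
  [/\ [bounded u x | x in [set: 'rV[R]_n]],
      upper_semicontinuous u &
      forall phi x, Cb2 phi -> Omega x ->
        (forall y, u y - phi y <= u x - phi x) -> (F x (u x) phi <= 0)%E].

Definition viscosity_supersolution u : Prop :=
  [/\ [bounded u x | x in [set: 'rV[R]_n]],
      lower_semicontinuous (EFin \o u) &
      forall phi x, Cb2 phi -> Omega x ->
        (forall y, u x - phi x <= u y - phi y) -> (0 <= F x (u x) phi)%E].

Definition dirichlet_subsolution g u : Prop :=
  viscosity_subsolution u /\ forall x, ~ Omega x -> u x <= g x.

Definition dirichlet_supersolution g u : Prop :=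
  viscosity_supersolution u /\ forall x, ~ Omega x -> g x <= u x.

End viscosity.

(* Main.v *)
(** Let p be the centre of an exterior ball of radius r touching the boundary at
    x. The function w = g(x) + e/2 + M W with W(z) = ((|z - p| - r)^+)^al is
    a barrier: at distance d from the ball, the part of the kernel above the
    nondegeneracy set S, where W loses half of its value d^al, contributes
    a negative term of order d^(al - sigma) to the nonlocal operator, while the
    contributions of |z| < N d, of |z| > N d and of the drift have the same order
    with constants that are small for N large and then al small. Taking M large
    gives a strict supersolution in a thin shell, and w above the constant k
    outside of it, where k is itself a supersolution because c >= gamma.
    Finitely many barriers cover the boundary up to the error e; the infimum of k
    and of these barriers over e = 1/(j + 1) is locally a finite minimum in
    Omega, hence a continuous supersolution, and it attains g on the boundary.
    All the estimates hold for each pair (a, b) separately, so the subsolution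
    comes from the data -g, -f. *)

(* The kernels are controlled only in mean over dyadic annuli, so every estimate is reduced to a
   moment of [enorm z] to a fixed power: [near_exp], above [sigma], inside a radius and [far_exp],
   below [sigma], outside it. All radii are multiples of d, and the curvature error depends only on
   d / r; hence [al] and the relative thickness [s0] of the shell depend neither on the touching
   point nor on [r], and the factor [M] can be chosen last. The obstacle at [sigma = 1] is the
   gradient term between the radii N d and 1: bounded by absolute values it may grow like log (1 /
   d). It is removed by the cancellation of first moments, for which the cut-off radius has to be a
   power of 1/2. The drift has size d^(al - 1), which d^(al - sigma) dominates only for sigma >= 1;
   this is where b = 0 for sigma < 1 enters. The barrier itself is never inserted into the operator.
   A test function touching it from below has the same gradient and smaller increments, so its
   second differences are bounded pointwise, and only these are integrated. *)
Require Import Defs.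
From HB Require Import structures.
From mathcomp Require Import all_boot all_order all_algebra.
From mathcomp Require Import all_classical all_reals all_analysis.
From mathcomp Require Import measurable_realfun.
From mathcomp Require Import ring lra.

Set Implicit Arguments.
Unset Strict Implicit.
Unset Printing Implicit Defensive.
Import Order.TTheory GRing.Theory Num.Theory.
Import numFieldNormedType.Exports.
Local Open Scope classical_set_scope.
Local Open Scope ring_scope.

(** * The Euclidean norm *)

Section euclidean_norm.
Context (R : realType) (n : nat).
Implicit Types (u v w x y : 'rV[R]_n) (a e : R).

Lemma dotmulC u v : dotmul u v = dotmul v u.
Proof. by apply: eq_bigr => i _; rewrite mulrC. Qed.

Lemma dotmulDl u v w : dotmul (u + v) w = dotmul u w + dotmul v w.
Proof. by rewrite -big_split; apply: eq_bigr => i _; rewrite mxE mulrDl. Qed.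

Lemma dotmulZl a u v : dotmul (a *: u) v = a * dotmul u v.
Proof. by rewrite /dotmul mulr_sumr; apply: eq_bigr => i _; rewrite mxE mulrA. Qed.

Lemma dotmulNl u v : dotmul (- u) v = - dotmul u v.
Proof. by rewrite -scaleN1r dotmulZl mulN1r. Qed.

Lemma dotmulDr u v w : dotmul u (v + w) = dotmul u v + dotmul u w.
Proof. by rewrite dotmulC dotmulDl !(dotmulC u). Qed.

Lemma dotmulZr a u v : dotmul u (a *: v) = a * dotmul u v.
Proof. by rewrite dotmulC dotmulZl dotmulC. Qed.

Lemma dotmulNr u v : dotmul u (- v) = - dotmul u v.
Proof. by rewrite dotmulC dotmulNl dotmulC. Qed.

Lemma dotmul0r u : dotmul u 0 = 0.
Proof. by rewrite -(scale0r u) dotmulZr mul0r. Qed.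

Lemma dotmul_ge0 u : 0 <= dotmul u u.
Proof. by apply: sumr_ge0 => i _; rewrite -expr2 sqr_ge0. Qed.

Lemma sqr_enorm u : enorm u ^+ 2 = dotmul u u.
Proof. by rewrite sqr_sqrtr ?dotmul_ge0. Qed.

Lemma enorm_ge0 u : 0 <= enorm u.
Proof. exact: sqrtr_ge0. Qed.

Lemma enorm0 : enorm (0 : 'rV[R]_n) = 0.
Proof. by rewrite /enorm dotmul0r sqrtr0. Qed.

Lemma enormN u : enorm (- u) = enorm u.
Proof. by rewrite /enorm dotmulNl dotmulNr opprK. Qed.

Lemma enormB u v : enorm (u - v) = enorm (v - u).
Proof. by rewrite -enormN opprB. Qed.

Lemma enormZ a u : enorm (a *: u) = `|a| * enorm u.
Proof.
by rewrite /enorm dotmulZl dotmulZr mulrA -expr2 sqrtrM ?sqr_ge0// sqrtr_sqr.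
Qed.

Lemma enorm_eq0 u : enorm u = 0 -> u = 0.
Proof.
move=> u0; have /eqP := sqr_enorm u.
rewrite u0 expr0n/= eq_sym psumr_eq0; last by move=> i _; rewrite -expr2 sqr_ge0.
move=> /allP h; apply/rowP => i; rewrite mxE.
have := h i; rewrite mem_index_enum /= mulf_eq0 => /(_ isT).
by case/orP => /eqP.
Qed.

Lemma enorm_gt0 u : (0 < enorm u) = (u != 0).
Proof.
rewrite lt_def enorm_ge0 andbT; congr (~~ _).
by apply/eqP/eqP => [/enorm_eq0//|->]; rewrite enorm0.
Qed.

Lemma cauchy_schwarz u v : `|dotmul u v| <= enorm u * enorm v.
Proof.
have [->|u0] := eqVneq u 0.
  by rewrite dotmulC dotmul0r normr0 mulr_ge0 ?enorm_ge0.
rewrite -[leRHS]ger0_norm ?mulr_ge0 ?enorm_ge0//.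
rewrite -ler_sqr ?nnegrE ?normr_ge0// !real_normK ?num_real//.
rewrite exprMn !sqr_enorm.
have a0 : 0 < dotmul u u by rewrite -sqr_enorm exprn_gt0// enorm_gt0.
have := dotmul_ge0 (dotmul u u *: v - dotmul u v *: u).
rewrite !(dotmulDl, dotmulDr, dotmulNl, dotmulNr, dotmulZl, dotmulZr).
rewrite (dotmulC v u) => h.
rewrite -(ler_pM2l a0); nra.
Qed.

Lemma dotmul_le u v : dotmul u v <= enorm u * enorm v.
Proof. exact: le_trans (ler_norm _) (cauchy_schwarz _ _). Qed.

Lemma enormD u v : enorm (u + v) <= enorm u + enorm v.
Proof.
rewrite -ler_sqr ?nnegrE ?addr_ge0 ?enorm_ge0// sqr_enorm.
rewrite dotmulDl !dotmulDr sqrrD !sqr_enorm (dotmulC v u).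
by have := dotmul_le u v; lra.
Qed.

Lemma enorm_lerB u v : enorm u - enorm v <= enorm (u - v).
Proof. by rewrite lerBlDr -[X in enorm X <= _](subrK v); exact: enormD. Qed.

Lemma enorm_dist u v : `|enorm u - enorm v| <= enorm (u - v).
Proof.
by rewrite ler_norml enorm_lerB andbT lerNl opprB enormB enorm_lerB.
Qed.

Lemma coord_le_enorm u i : `|u ord0 i| <= enorm u.
Proof.
rewrite -ler_sqr ?nnegrE ?enorm_ge0// real_normK ?num_real// sqr_enorm.
rewrite /dotmul (bigD1 i)//= -expr2 lerDl sumr_ge0// => j _.
by rewrite -expr2 sqr_ge0.
Qed.

Lemma enorm_lt_coord u e : (0 < n)%N -> 0 < e ->
  (forall i, `|u ord0 i| < e / n%:R) -> enorm u < e.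
Proof.
move=> n0 e0 h; have n1 : 1 <= n%:R :> R by rewrite ler1n.
rewrite -ltr_sqr ?nnegrE ?enorm_ge0// ?(ltW e0)// sqr_enorm.
have en0 : 0 < e / n%:R by rewrite divr_gt0// (lt_le_trans ltr01).
apply: (@lt_le_trans _ _ (\sum_(i < n) (e / n%:R) ^+ 2)).
  apply: ltr_sum; first by apply/hasP; exists (Ordinal n0) => //; rewrite mem_index_enum.
  move=> i _; rewrite -expr2 -(@real_normK _ (u ord0 i)) ?num_real//.
  by rewrite ltr_sqr ?nnegrE// ltW.
rewrite sumr_const card_ord -[leLHS]mulr_natl expr_div_n mulrCA ler_piMr ?sqr_ge0//.
have n0' : n%:R != 0 :> R by rewrite gt_eqF ?(lt_le_trans ltr01).
rewrite -exprVn exprS expr1 mulrA divff// mul1r invf_le1//.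
exact: lt_le_trans n1.
Qed.

Lemma dotmul_delta u i : dotmul u (delta_mx ord0 i) = u ord0 i.
Proof.
rewrite /dotmul (bigD1 i)//= big1 ?addr0 => [|j ji].
  by rewrite mxE !eqxx mulr1.
by rewrite mxE (negbTE ji) mulr0.
Qed.

End euclidean_norm.

Section euclidean_topology.
Context (R : realType) (n : nat).
Implicit Types (x y : 'rV[R]_n) (e : R).

Lemma nbhs_enormP x (U : set 'rV[R]_n) : (0 < n)%N ->
  nbhs x U <-> exists2 e : R, 0 < e & eball x e `<=` U.
Proof.
move=> n0; split.
  move=> /nbhs_ballP[e /= e0 eU]; exists e => // y yx; apply: eU.
  split=> // i j; rewrite (ord1 i) /ball/= distrC.
  apply: le_lt_trans yx; have := coord_le_enorm (y - x) j.
  by rewrite !mxE.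
move=> [e e0 eU]; apply/nbhs_ballP; exists (e / n%:R) => /=.
  by rewrite divr_gt0// ltr0n.
move=> y [_ yx]; apply: eU; apply: enorm_lt_coord => // i.
by rewrite !mxE distrC; exact: yx.
Qed.

Lemma nbhs_eball x e : (0 < n)%N -> 0 < e -> nbhs x (eball x e).
Proof. by move=> n0 e0; apply/(nbhs_enormP _ _ n0); exists e. Qed.

Lemma continuous_enormP (f : 'rV[R]_n -> R) x : (0 < n)%N ->
  {for x, continuous f} <->
  forall e, 0 < e -> exists2 d : R, 0 < d &
    forall y, enorm (y - x) < d -> `|f y - f x| < e.
Proof.
move=> n0; split.
  move=> fx e e0; have : nbhs x (f @^-1` (ball (f x) e)).
    by apply: fx; exact: nbhsx_ballx.
  move=> /(nbhs_enormP _ _ n0)[d d0 h]; exists d => // y yx.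
  by rewrite distrC; exact: h.
move=> h U /nbhs_ballP[e /= e0 eU]; have [d d0 hd] := h _ e0.
apply/(nbhs_enormP _ _ n0); exists d => // y yx /=; apply: eU.
by rewrite /ball/= distrC; exact: hd.
Qed.

Lemma continuous_enorm_sub p : (0 < n)%N ->
  continuous (fun x : 'rV[R]_n => enorm (x - p)).
Proof.
move=> n0 x; apply/(continuous_enormP _ _ n0) => e e0; exists e => // y yx.
by apply: le_lt_trans (enorm_dist _ _) _; rewrite opprB addrA subrK.
Qed.

End euclidean_topology.

(** * Borel sets and balls *)

Section borel_sets.
Context (R : realType) (n : nat).

Definition box (q : 'rV[R]_n) (e : R) : set 'rV[R]_n :=
  [set v | forall i, `|v ord0 i - q ord0 i| < e].

Lemma measurable_box q e : measurable (box q e).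
Proof.
rewrite (_ : box q e = \big[setI/setT]_(i < n)
    [set v : 'rV[R]_n | `|v ord0 i - q ord0 i| < e]).
  apply: bigsetI_measurable => i _.
  rewrite (_ : [set _ | _] = @rV_coord R n i @^-1` (ball (q ord0 i) e)).
    rewrite -[X in measurable X]setTI; apply: measurable_rV_coord => //.
    exact: measurable_ball.
  by apply/seteqP; split => v; rewrite /ball/= distrC.
rewrite -bigcap_seq; apply/seteqP; split => v /= h i.
  by move=> _; exact: h.
by apply: (h i); exact: mem_index_enum.
Qed.

(** The sigma-algebra is generated by the coordinates, so an open set has to be exhibited as a
    countable union of cubes with rational centres and half-sides 1/(m + 1). *)
Lemma open_measurable_rV (U : set 'rV[R]_n) : open U -> measurable U.
Proof.
move=> oU.
pose D (i : 'rV[rat]_n * nat) := box (map_mx ratr i.1) i.2.+1%:R^-1.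
pose F (i : 'rV[rat]_n * nat) := if pselect (D i `<=` U) then D i else set0.
suff -> : U = \bigcup_i F i.
  apply: countable_bigcupT_measurable => // i; rewrite /F.
  by case: pselect => ?; [exact: (measurable_box (map_mx ratr i.1))|exact: measurable0].
apply/seteqP; split => [v Uv|v [i _]]; last first.
  by rewrite /F; case: pselect => // h /h.
have /nbhs_ballP[e /= e0 eU] : nbhs v U by exact: open_nbhs_nbhs.
(* A cube of half-side [t] that contains [v] stays within [2 * t] of [v] in the sup norm; [m] makes
   this at most [e]. *)
pose m := Num.truncn (2 / e).
pose t : R := m.+1%:R^-1.
have me : 2 * t <= e.
  rewrite /t ler_pdivrMr ?ltr0n// mulrC -ler_pdivrMr//.
  by apply: ltW; exact: truncnS_gt.
have m0 : 0 < t :> R by rewrite invr_gt0 ltr0n.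
have qP i : exists q : rat, `|v ord0 i - ratr q| < t.
  have : v ord0 i - t < v ord0 i + t by lra.
  case/rat_in_itvoo => q; rewrite in_itv/= => /andP[h1 h2].
  by exists q; rewrite ltr_norml; apply/andP; split; lra.
have [q hq] := choice qP.
exists (\row_i q i, m) => //; rewrite /F.
have Dv : D (\row_i q i, m) v by move=> i; rewrite !mxE; exact: hq.
case: pselect => // nDU; exfalso; apply: nDU => w Dw; apply: eU; split => // i j.
rewrite (ord1 i) /ball/=; apply: lt_le_trans me.
have := Dv j; have := Dw j; rewrite !mxE => h1 h2.
rewrite -(subrK (ratr (q j)) (v ord0 j)) -addrA.
apply: le_lt_trans (ler_normD _ _) _.
by rewrite [X in _ + X]distrC mulrDl mul1r ltrD.
Qed.

Lemma continuous_measurable_rV (f : 'rV[R]_n -> R) :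
  continuous f -> measurable_fun setT f.
Proof.
move=> /continuousP cf; apply: (measurability (@RGenOpens.G R)).
  exact: RGenOpens.measurableE.
move=> _ [_ [a [b ->] <-]]; rewrite setTI; apply: open_measurable_rV.
by apply: cf; exact: interval_open.
Qed.

End borel_sets.

Section lebesgue_sets.
Context (R : realType) (n : nat).
Local Notation leb := (@lebesgue_rV R n).

Lemma measurable_lebesgueT (U : set 'rV[R]_n) :
  measurable U -> measurable (U : set (lebesgueT R n)).
Proof.
by move=> mU; apply: sub_caratheodory; exact: sub_sigma_algebra.
Qed.

Lemma measurable_fun_lebesgueT d (T : measurableType d) (f : 'rV[R]_n -> T) :
  measurable_fun setT f -> measurable_fun [set: lebesgueT R n] f.
Proof.
move=> mf _ Y mY; apply: measurable_lebesgueT; exact: mf.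
Qed.

Lemma continuous_measurable_lebesgueT (f : 'rV[R]_n -> R) :
  continuous f -> measurable_fun [set: lebesgueT R n] f.
Proof.
by move=> cf; apply: measurable_fun_lebesgueT; exact: continuous_measurable_rV.
Qed.

Lemma lebesgue_rVE (U : set 'rV[R]_n) : measurable U ->
  leb U = borel_lebesgue_rV R n U.
Proof. by move=> mU; rewrite [LHS]measurable_mu_extE. Qed.

End lebesgue_sets.

Lemma borel_lebesgue_box (R : realType) (n : nat) (e : R) : 0 < e ->
  borel_lebesgue_rV R n (box 0 e) = ((2 * e) ^+ n)%:E.
Proof.
move=> e0; elim: n => [|n ih].
  rewrite expr0 /= (_ : box _ _ = setT); first exact: diracT.
  by apply/seteqP; split => // v _ [].
have -> : borel_lebesgue_rV R n.+1 (box 0 e) =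
    ((@lebesgue_measure R \x borel_lebesgue_rV R n)
      (ball (0%R:R) e `*` box (0%R : 'rV[R]_n) e))%E.
  rewrite /= /lebesgue_rV_succ /pushforward; congr (_ _).
  apply/seteqP; split => [[x v] h|[x v] [/= hx hv] i].
    split => [|i] /=.
      have : `|rV_cons (x, v) ord0 (lshift n ord0)| < e.
        by have := h (lshift n (ord0 : 'I_1)); rewrite [X in _ - X]mxE subr0.
      by rewrite row_mxEl mxE /ball/= sub0r normrN.
    have : `|rV_cons (x, v) ord0 (rshift 1 i)| < e.
      by have := h (rshift 1 i : 'I_(1 + n)); rewrite [X in _ - X]mxE subr0.
    by rewrite row_mxEr mxE subr0.
  rewrite [X in _ - X]mxE subr0 -(splitK (i : 'I_(1 + n))).
  case: (fintype.split _) => j /=.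
    suff : `|rV_cons (x, v) ord0 (lshift n j)| < e by [].
    by rewrite row_mxEl mxE -normrN -sub0r.
  suff : `|rV_cons (x, v) ord0 (rshift 1 j)| < e by [].
  by have := hv j; rewrite row_mxEr mxE subr0.
rewrite product_measure1E; first last.
- exact: measurable_box.
- exact: measurable_ball.
by rewrite ih /= lebesgue_measure_ball ?(ltW e0)// -EFinM exprS mulr_natl.
Qed.

Section lebesgue_ball.
Context (R : realType) (n : nat) (n0 : (0 < n)%N).
Local Notation leb := (@lebesgue_rV R n).

Lemma measurable_eball (x : 'rV[R]_n) e :
  measurable (eball x e : set (lebesgueT R n)).
Proof.
suff : open (eball x e) by move=> /open_measurable_rV/measurable_lebesgueT.
rewrite openE => y yx.
apply/(nbhs_enormP _ _ n0); exists (e - enorm (y - x)); first by rewrite subr_gt0.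
move=> z zy; rewrite /eball/= -(subrK y z) -addrA.
by apply: le_lt_trans (enormD _ _) _; move: zy; rewrite /eball/=; lra.
Qed.

(** The ball contains the cube of half-side e / n; this crude volume is the origin of the factor (2
    / n)^n in the later constants. *)
Lemma lebesgue_eball_ge (e : R) : 0 < e ->
  (((2 / n%:R) ^+ n * e ^+ n)%:E <= leb (eball 0 e))%E.
Proof.
move=> e0; have en0 : 0 < e / n%:R by rewrite divr_gt0// ltr0n.
rewrite -exprMn mulrAC -mulrA -(borel_lebesgue_box _ en0) -lebesgue_rVE; last exact: measurable_box.
apply: le_measure.
- by rewrite inE; apply: measurable_lebesgueT; exact: measurable_box.
- by rewrite inE; exact: measurable_eball.
move=> v h; rewrite /eball/= subr0; apply: enorm_lt_coord => // i.
by have := h i; rewrite mxE subr0.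
Qed.

End lebesgue_ball.

(** * Moments of the kernels *)

Section kernel_moments.
Context (R : realType) (n : nat) (n0 : (0 < n)%N).
Local Notation leb := (@lebesgue_rV R n).
Context (sigma Lam : R) (K : 'rV[R]_n -> R).
Hypothesis hK : kernel_upper_bounds sigma Lam K.

Definition annulus (d : R) : set 'rV[R]_n := eball 0 (2 * d) `\` eball 0 d.

Lemma annulusP d z : annulus d z <-> d <= enorm z < 2 * d.
Proof.
rewrite /annulus /eball /setD /= subr0; split => [[-> /negP]|/andP[h1 ->]].
  by rewrite -leNgt => ->.
by split => //; apply/negP; rewrite -leNgt.
Qed.

Lemma measurable_annulus d : measurable (annulus d : set (lebesgueT R n)).
Proof. by apply: measurableD; exact: measurable_eball. Qed.

Lemma measurable_enorm : measurable_fun [set: lebesgueT R n] (@enorm R n).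
Proof.
apply: continuous_measurable_lebesgueT.
rewrite (_ : @enorm R n = fun x => enorm (x - 0)).
  exact: continuous_enorm_sub.
by apply/funext => x; rewrite subr0.
Qed.

Lemma measurable_enorm_powR p :
  measurable_fun [set: lebesgueT R n] (fun z : 'rV[R]_n => enorm z `^ p).
Proof.
exact: (measurableT_comp (measurable_powR p) measurable_enorm).
Qed.

Lemma kernel_ge0 z : 0 <= K z.
Proof. by have [] := hK. Qed.

Lemma measurable_kernel : measurable_fun [set: lebesgueT R n] K.
Proof. by have [] := hK. Qed.

Let M p (z : 'rV[R]_n) : \bar R := (enorm z `^ p * K z)%:E.

Let mM p (D : set (lebesgueT R n)) : measurable_fun D (M p).
Proof.
apply: measurable_funTS; apply/measurable_EFinP.
by apply: measurable_funM; [exact: measurable_enorm_powR|exact: measurable_kernel].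
Qed.

Let M0 p z : (0 <= M p z)%E.
Proof. by rewrite lee_fin mulr_ge0 ?powR_ge0 ?kernel_ge0. Qed.

Lemma annulus_moment p d : 0 < d -> 0 <= p ->
  (\int[leb]_(z in annulus d) M p z <=
   (2 `^ p * ((2 - sigma) * Lam) * d `^ (p - sigma))%:E)%E.
Proof.
move=> d0 p0; have [_ _ /(_ d d0)[h _]] := hK.
apply: (@le_trans _ _ (\int[leb]_(z in annulus d) (((2 * d) `^ p)%:E * (K z)%:E))%E).
  apply: ge0_le_integral.
  - exact: measurable_annulus.
  - by move=> z _; exact: M0.
  - exact: mM.
  - apply: measurable_funTS; apply/measurable_EFinP.
    by apply: measurable_funM; [exact: measurable_cst|exact: measurable_kernel].
  - move=> z /annulusP/andP[h1 h2]; rewrite -EFinM lee_fin ler_wpM2r ?kernel_ge0//.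
    by apply: ge0_ler_powR => //; rewrite ?nnegrE ?enorm_ge0 ?mulr_ge0 ?(ltW d0) ?(ltW h2).
rewrite ge0_integralZl_EFin; first last.
- exact: powR_ge0.
- apply: measurable_funTS; apply/measurable_EFinP.
  exact: measurable_kernel.
- by move=> z _; rewrite lee_fin kernel_ge0.
- exact: measurable_annulus.
apply: le_trans (lee_wpmul2l _ h) _; first by rewrite lee_fin powR_ge0.
rewrite -EFinM lee_fin powRM// ?(ltW d0)// powRD; last first.
  by apply/implyP => _; rewrite gt_eqF.
rewrite le_eqVlt; apply/orP; left; apply/eqP; ring.
Qed.

Lemma geometric_annuli_moment p t d : 0 < d -> 0 <= p -> 0 < t ->
  (forall i j, (i < j)%N -> 2 * t ^+ i <= t ^+ j \/ 2 * t ^+ j <= t ^+ i) ->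
  t `^ (p - sigma) < 1 ->
  (\int[leb]_(z in \bigcup_j annulus (t ^+ j * d)) M p z <=
   (2 `^ p * ((2 - sigma) * Lam) * d `^ (p - sigma) / (1 - t `^ (p - sigma)))%:E)%E.
Proof.
move=> d0 p0 t0 ht tps.
set A := 2 `^ p * _ * _; set s := t `^ _ in tps *.
(* No sign of [Lam] is given; [A] is nonnegative because it bounds the integral of a nonnegative
   function. *)
have A0 : 0 <= A.
  have := annulus_moment d0 p0; rewrite -lee_fin; apply: le_trans.
  by apply: integral_ge0.
have s0 : 0 <= s by exact: powR_ge0.
rewrite ge0_integral_bigcup//; first last.
- apply: ltn_trivIset => j i ij; apply/seteqP; split => //.
  move=> z [/annulusP/andP[a1 a2] /annulusP/andP[b1 b2]].
  case: (ht _ _ ij) => h.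
    have := ler_wpM2r (ltW d0) h; rewrite -mulrA => {}h.
    by have := lt_le_trans a2 (le_trans h b1); rewrite ltxx.
  have := ler_wpM2r (ltW d0) h; rewrite -mulrA => {}h.
  by have := lt_le_trans b2 (le_trans h a1); rewrite ltxx.
- by move=> j; exact: measurable_annulus.
apply: lime_le; first by apply: is_cvg_nneseries => j _ _; exact: integral_ge0.
near=> m => /=.
apply: (@le_trans _ _ (\sum_(0 <= j < m) (A * s ^+ j)%:E)%E).
  apply: lee_sum => j _.
  apply: le_trans (annulus_moment _ p0) _; first by rewrite mulr_gt0// exprn_gt0.
  rewrite lee_fin powRM ?exprn_ge0 ?(ltW t0) ?(ltW d0)//.
  rewrite -powR_mulrn ?(ltW t0)// -powRrM.
  rewrite [(p - sigma) * _]mulrC powRrM powR_mulrn ?(ltW t0)// le_eqVlt.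
  by apply/orP; left; apply/eqP; rewrite /A; ring.
rewrite sumEFin lee_fin -mulr_sumr ler_wpM2l//.
rewrite -[leRHS]mul1r ler_pdivlMr ?subr_gt0//.
have -> : (\sum_(0 <= j < m) s ^+ j) * (1 - s) = 1 - s ^+ m.
  by rewrite big_mkord mulrC -opprB mulNr -subrX1 opprB.
by rewrite gerBl exprn_ge0.
Unshelve. all: by end_near.
Qed.


Lemma near_annuli r : 0 < r ->
  eball 0 r `\ 0 `<=` \bigcup_j annulus (2^-1 ^+ j * (r / 2)).
Proof.
move=> r0 z [/=]; rewrite /eball/= subr0 => zr /eqP z0.
have {}z0 : 0 < enorm z by rewrite enorm_gt0.
have ex : exists j, 2^-1 ^+ j * (r / 2) <= enorm z.
  have := @truncnS_gt R (r / enorm z); set m := Num.truncn _ => h.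
  exists m; rewrite exprVn mulrC ler_pdivrMr ?exprn_gt0//.
  have : m.+1%:R <= 2 ^+ m :> R by rewrite -natrX ler_nat ltn_expl.
  move=> h2; rewrite ltr_pdivrMr// in h.
  apply: (@le_trans _ _ r); first by rewrite ler_pdivrMr// ler_peMr ?(ltW r0)// ler1n.
  by apply: ltW; apply: lt_le_trans h _; rewrite mulrC ler_wpM2l ?(ltW z0).
have [j hj hmin] := ex_minnP ex.
exists j => //; apply/annulusP; rewrite hj/=.
case: j hj hmin => [|j] hj hmin; first by rewrite expr0 mul1r mulrC divfK.
rewrite ltNge; apply/negP => h; suff /hmin : 2^-1 ^+ j * (r / 2) <= enorm z by rewrite ltnn.
by apply: le_trans h; rewrite exprS !mulrA divff// mul1r.
Qed.

Lemma far_annuli r : 0 < r ->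
  ~` eball 0 r `<=` \bigcup_j annulus (2 ^+ j * r).
Proof.
move=> r0 z /= /negP; rewrite /eball /= subr0 -leNgt => zr.
have ex : exists j, enorm z < 2 ^+ j.+1 * r.
  have := @truncnS_gt R (enorm z / r); set m := Num.truncn _ => h.
  exists m; rewrite -ltr_pdivrMr//; apply: lt_le_trans h _.
  by rewrite -natrX ler_nat expnS (leq_trans (ltn_expl m (isT : 1 < 2)%N))// leq_pmull.
have [j hj hmin] := ex_minnP ex.
exists j => //; apply/annulusP; rewrite mulrA -exprS hj andbT.
case: j hj hmin => [|j] hj hmin; first by rewrite expr0 mul1r.
rewrite leNgt; apply/negP => h; by have /hmin := h; rewrite ltnn.
Qed.

Lemma moment_integrable p (D E : set 'rV[R]_n) c : 0 < p ->
  measurable (D : set (lebesgueT R n)) -> measurable (E : set (lebesgueT R n)) ->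
  D `\ 0 `<=` E -> (\int[leb]_(z in E) M p z <= c%:E)%E ->
  leb.-integrable setT (EFin \o (fun z => enorm z `^ p * \1_D z * K z)) /\
  \int[leb]_z (enorm z `^ p * \1_D z * K z) <= c.
Proof.
move=> p0 mD mE DE hc.
pose F z := enorm z `^ p * \1_D z * K z.
have F0 z : 0 <= F z by rewrite !mulr_ge0 ?powR_ge0 ?kernel_ge0// indicE ler0n.
have mF : measurable_fun [set: lebesgueT R n] (EFin \o F).
  apply/measurable_EFinP; apply: measurable_funM; last exact: measurable_kernel.
  by apply: measurable_funM; [exact: measurable_enorm_powR|exact: measurable_indic].
have hF : (\int[leb]_z (F z)%:E <= c%:E)%E.
  apply: le_trans hc; rewrite [leRHS]integral_mkcond.
  apply: ge0_le_integral.
  - exact: measurableT.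
  - by move=> z _; rewrite lee_fin.
  - exact: mF.
  - exact: (measurable_restrictT _ _).1.
  move=> z _; rewrite /F patchE indicE.
  have [->|z0] := eqVneq z 0.
    by rewrite enorm0 powR0 ?gt_eqF// !mul0r; case: ifP.
  case: ifPn => zE.
    rewrite lee_fin; case: (_ \in D); last by rewrite mulr0 mul0r mulr_ge0 ?powR_ge0 ?kernel_ge0.
    by rewrite mulr1.
  have /negbTE -> : z \notin D; last by rewrite mulr0 mul0r.
  apply: contra zE; rewrite !inE => zD; apply: DE; split => //=; exact/eqP.
have iF : leb.-integrable setT (EFin \o F).
  apply/integrableP; split => //.
  rewrite (eq_integral (fun z : lebesgueT R n => (F z)%:E)); last first.
    by move=> z _; rewrite /= ger0_norm.
  by apply: le_lt_trans hF _; exact: ltry.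
split => //; rewrite -lee_fin /Rintegral fineK//.
exact: integrable_fin_num.
Qed.

End kernel_moments.

Section moment_bounds.
Context (R : realType) (n : nat) (n0 : (0 < n)%N) (sigma Lam p : R).
Local Notation leb := (@lebesgue_rV R n).

(** The constant is chosen before the kernel and the radius, hence is uniform over the whole
    family. *)
Lemma near_moment : 0 < p -> sigma < p -> exists2 C, 0 <= C &
  forall (K : 'rV[R]_n -> R) r, kernel_upper_bounds sigma Lam K -> 0 < r ->
  leb.-integrable setT (EFin \o (fun z => enorm z `^ p * \1_(eball 0 r) z * K z)) /\
  \int[leb]_z (enorm z `^ p * \1_(eball 0 r) z * K z) <= C * r `^ (p - sigma).
Proof.
move=> p0 sp.
pose C0 := 2 `^ p * ((2 - sigma) * Lam) * 2^-1 `^ (p - sigma) / (1 - 2^-1 `^ (p - sigma)).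
(* The maximum with 0 makes the constant nonnegative whatever the sign of [Lam]. *)
exists (Num.max 0 C0); first by rewrite le_max lexx.
move=> K r hK r0.
have r20 : 0 < r / 2 by rewrite divr_gt0.
have ht (i j : nat) : (i < j)%N ->
    2 * 2^-1 ^+ i <= 2^-1 ^+ j :> R \/ 2 * 2^-1 ^+ j <= 2^-1 ^+ i :> R.
  move=> ij; right; case: j ij => // j; rewrite ltnS => ij.
  rewrite exprS mulrA divff// mul1r !exprVn lef_pV2 ?posrE ?exprn_gt0//.
  by rewrite ler_eXn2l ?ltr1n.
have t1 : 2^-1 `^ (p - sigma) < 1 :> R.
  apply: (@lt_le_trans _ _ (1 `^ (p - sigma))); last by rewrite powR1.
  rewrite gt0_ltr_powR ?subr_gt0// ?nnegrE ?invr_ge0//.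
  by rewrite invf_lt1// ltr1n.
have := geometric_annuli_moment n0 hK r20 (ltW p0) _ ht t1.
rewrite invr_gt0 => /(_ (ltr0n _ 2)) h.
have [|||h1 h2] := @moment_integrable R n n0 sigma Lam K hK p (eball 0 r) _ _ p0 _ _ _ h.
- exact: measurable_eball.
- by apply: bigcupT_measurable => j; exact: measurable_annulus.
- exact: near_annuli.
split => //; apply: le_trans h2 _.
rewrite powRM ?(ltW r0) ?invr_ge0//.
apply: (@le_trans _ _ (C0 * r `^ (p - sigma))).
  by rewrite le_eqVlt; apply/orP; left; apply/eqP; rewrite /C0; ring.
by rewrite ler_wpM2r ?powR_ge0// le_max lexx orbT.
Qed.

Lemma far_moment : 0 < p -> p < sigma -> exists2 C, 0 <= C &
  forall (K : 'rV[R]_n -> R) r, kernel_upper_bounds sigma Lam K -> 0 < r ->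
  leb.-integrable setT (EFin \o (fun z => enorm z `^ p * \1_(~` eball 0 r) z * K z)) /\
  \int[leb]_z (enorm z `^ p * \1_(~` eball 0 r) z * K z) <= C * r `^ (p - sigma).
Proof.
move=> p0 sp.
pose C0 := 2 `^ p * ((2 - sigma) * Lam) / (1 - 2 `^ (p - sigma)).
exists (Num.max 0 C0); first by rewrite le_max lexx.
move=> K r hK r0.
have ht (i j : nat) : (i < j)%N ->
    2 * 2 ^+ i <= 2 ^+ j :> R \/ 2 * 2 ^+ j <= 2 ^+ i :> R.
  by move=> ij; left; rewrite -exprS ler_eXn2l ?ltr1n.
have t1 : 2 `^ (p - sigma) < 1 :> R.
  rewrite -opprB powRN invf_lt1 ?powR_gt0//.
  apply: (@le_lt_trans _ _ (1 `^ (sigma - p))); first by rewrite powR1.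
  by rewrite gt0_ltr_powR ?subr_gt0// ?nnegrE// ltr1n.
have h := geometric_annuli_moment n0 hK r0 (ltW p0) (ltr0n _ 2) ht t1.
have [|||h1 h2] := @moment_integrable R n n0 sigma Lam K hK p (~` eball 0 r) _ _ p0 _ _ _ h.
- by apply: measurableC; exact: measurable_eball.
- by apply: bigcupT_measurable => j; exact: measurable_annulus.
- by move=> z [/= zr _]; exact: far_annuli.
split => //; apply: le_trans h2 _.
apply: (@le_trans _ _ (C0 * r `^ (p - sigma))).
  by rewrite le_eqVlt; apply/orP; left; apply/eqP; rewrite /C0; ring.
by rewrite ler_wpM2r ?powR_ge0// le_max lexx orbT.
Qed.

End moment_bounds.

(** * Test functions *)

Section taylor.
Context (R : realType) (n : nat).
Implicit Types (phi : 'rV[R]_n -> R) (x y z a e : 'rV[R]_n).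

Lemma is_derive_line phi a e (t : R) : derivable phi (a + t *: e) e ->
  is_derive t 1 (fun s : R => phi (a + s *: e)) ('D_e phi (a + t *: e)).
Proof.
have E : (fun h : R => h^-1 *: (((fun s : R => phi (a + s *: e)) \o shift t) (h *: (1 : R))
      - phi (a + t *: e))) =
    (fun h : R => h^-1 *: ((phi \o shift (a + t *: e)) (h *: e) - phi (a + t *: e))).
  apply/funext => h /=; congr (_ *: (phi _ - _)).
  by rewrite [h *: (1 : R)]mulr1 scalerDl addrCA.
by move=> d; apply: DeriveDef; rewrite /derivable /derive E.
Qed.

Lemma mvt_line phi a e (s : R) : (forall x, derivable phi x e) ->
  exists2 c : R, `|c| <= `|s| & phi (a + s *: e) - phi a = 'D_e phi (a + c *: e) * s.
Proof.
move=> dphi; pose h (t : R) := phi (a + t *: e).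
have dh (t : R) : is_derive t (1 : R) h ('D_e phi (a + t *: e)) by exact: is_derive_line.
have ch (b c : R) : {within `[b, c], continuous h}.
  apply: derivable_within_continuous => t _; by have [] := dh t.
have h0 : h 0 = phi a by rewrite /h scale0r addr0.
have [s0|s0|s0] := ltgtP s 0.
- have [c] := MVT s0 (fun t _ => dh t) (ch s 0).
  rewrite in_itv/= => /andP[c1 c2] hc; exists c.
    by rewrite !ltr0_norm// lerN2 ltW.
  by rewrite -h0 -[phi _]/(h s) -opprB hc sub0r mulrN opprK.
- have [c] := MVT s0 (fun t _ => dh t) (ch 0 s).
  rewrite in_itv/= => /andP[c1 c2] hc; exists c.
    by rewrite !gtr0_norm// ltW.
  by rewrite -h0 -[phi _]/(h s) hc subr0.
by exists 0; rewrite ?normr0// s0 scale0r addr0 subrr mulr0.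
Qed.

Lemma ler_enorm_coord (u v : 'rV[R]_n) :
  (forall i, `|u ord0 i| <= `|v ord0 i|) -> enorm u <= enorm v.
Proof.
move=> uv; apply: ler_wsqrtr; apply: ler_sum => i _.
rewrite -!expr2 -(real_normK (num_real (u _ _))) -(real_normK (num_real (v _ _))).
by rewrite lerXn2r ?nnegrE.
Qed.

(* The increment is telescoped along the coordinate axes because [Cb2] only
   provides the partial derivatives. *)
Lemma Cb2_taylor phi x : (0 < n)%N -> Cb2 phi ->
  exists C r : R, [/\ 0 <= C, 0 < r & forall z, enorm z < r ->
    `|phi (x + z) - phi x - dotmul (grad phi x) z| <= C * enorm z ^+ 2].
Proof.
move=> n0 [_ hphi].
have hU i : exists p : R * R, [/\ 0 <= p.1, 0 < p.2 & forall y, enorm (y - x) < p.2 ->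
    `|'D_(delta_mx ord0 i) phi y - 'D_(delta_mx ord0 i) phi x| <= p.1 * enorm (y - x)].
  have [_ /(_ x)[U xU [M [Mr hM]]]] := hphi i.
  pose k := `|M| + 1.
  have kM : M < k by rewrite (le_lt_trans (ler_norm _))// ltrDl.
  have k0 : 0 <= k by rewrite addr_ge0.
  have [r r0 rU] := (nbhs_enormP _ _ n0).1 xU.
  exists (k, r); split => //= y yx.
  have := hM k kM (y, x) (conj (rU _ yx) (nbhs_singleton xU)).
  move=> /= /le_trans; apply; apply: ler_wpM2l => //.
  rewrite [leLHS]/Num.Def.normr/= mx_normrE; apply/bigmax_leP; split => [|[i' j] _ /=].
    exact: enorm_ge0.
  by rewrite (ord1 i') coord_le_enorm.
have [p hp] := choice hU.
pose r := \big[Num.min/1]_(i < n) (p i).2.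
pose L := \sum_(i < n) (p i).1.
have r0 : 0 < r.
  by rewrite /r; elim/big_rec: _ => // i s _ s0; rewrite lt_min s0 andbT; have [] := hp i.
have L0 : 0 <= L by apply: sumr_ge0 => i _; have [] := hp i.
exists L, r; split => // z zr.
pose T k : 'rV[R]_n := \row_i (if (i < k)%N then z ord0 i else 0).
have T0 : T 0%N = 0 by apply/rowP => i; rewrite !mxE.
have Tn : T n = z by apply/rowP => i; rewrite !mxE ltn_ord.
have TS (k : 'I_n) : T k.+1 = T k + z ord0 k *: delta_mx ord0 k.
  apply/rowP => i; rewrite !mxE eqxx/= ltnS leq_eqVlt -val_eqE /=.
  case: (ltngtP i k) => ik /=; rewrite ?mulr0 ?addr0 ?mulr1 ?add0r//.
  by congr (z _ _); apply: val_inj.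
have -> : phi (x + z) - phi x - dotmul (grad phi x) z =
    \sum_(k < n) (phi (x + T k.+1) - phi (x + T k)
                   - 'D_(delta_mx ord0 k) phi x * z ord0 k).
  rewrite sumrB -(big_mkord xpredT (fun k => phi (x + T k.+1) - phi (x + T k))).
  rewrite telescope_sumr// Tn T0 addr0; congr (_ - _).
  by apply: eq_bigr => k _; rewrite mxE.
apply: le_trans (ler_norm_sum _ _ _) _; rewrite /L mulr_suml; apply: ler_sum => k _.
have [c cz] := @mvt_line phi (x + T k) (delta_mx ord0 k) (z ord0 k) (hphi k).1.
rewrite -addrA -TS => ->; rewrite -mulrBl normrM.
set y := x + T k + _.
have yx : enorm (y - x) <= enorm z.
  have -> : y - x = T k + c *: delta_mx ord0 k.
    by rewrite /y -(addrA x) [LHS]addrC addKr.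
  apply: ler_enorm_coord => i; rewrite !mxE eqxx/= -val_eqE/=.
  case: (ltngtP i k) => ik /=; rewrite ?mulr0 ?addr0 ?mulr1 ?add0r ?normr0//.
  by have -> : i = k by exact: val_inj.
have yr : enorm (y - x) < (p k).2.
  apply: le_lt_trans yx (lt_le_trans zr _).
  by rewrite /r (bigD1 k)//= ge_min lexx.
have [p0 _ /(_ _ yr) hk] := hp k.
rewrite expr2 mulrA ler_pM ?normr_ge0// ?coord_le_enorm//.
by apply: le_trans hk _; rewrite ler_wpM2l.
Qed.

Lemma Cb2_continuous phi : (0 < n)%N -> Cb2 phi -> continuous phi.
Proof.
move=> n0 hphi x; apply/(continuous_enormP _ _ n0) => e e0.
have [C [r [C0 r0 h]]] := Cb2_taylor x n0 hphi.
pose G := enorm (grad phi x); have G0 : 0 <= G by exact: enorm_ge0.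
pose d := Num.min (Num.min r 1) (e / (C + G + 1)).
have D0 : 0 < C + G + 1 by rewrite ltr_wpDl// addr_ge0.
exists d; first by rewrite !lt_min r0 ltr01 divr_gt0.
move=> y; rewrite !lt_min => /andP[/andP[yr y1]]; rewrite ltr_pdivlMr// => ye.
have := h _ yr; rewrite subrKC; set z := y - x in yr y1 ye * => hz.
have z0 : 0 <= enorm z by exact: enorm_ge0.
have h1 := cauchy_schwarz (grad phi x) z.
have h2 : `|phi y - phi x| <= C * enorm z ^+ 2 + G * enorm z.
  rewrite -(subrK (dotmul (grad phi x) z) (phi y - phi x)).
  by apply: le_trans (ler_normD _ _) _; rewrite lerD.
apply: le_lt_trans h2 _; apply: le_lt_trans ye.
have : C * enorm z ^+ 2 <= C * enorm z by rewrite ler_wpM2l// expr2 ler_piMr// ltW.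
by move=> h3; nra.
Qed.

(** With [v] the difference of the two gradients and [z = t *: v], the Taylor bound and the
    hypothesis give t |v|^2 <= (C + C') t^2 |v|^2, which fails for small [t] unless [v = 0]. A bound
    from one side is thus enough. *)
Lemma grad_eq_of_le phi x q (C r : R) : (0 < n)%N -> Cb2 phi -> 0 < r ->
  (forall z, enorm z < r -> phi (x + z) - phi x <= dotmul q z + C * enorm z ^+ 2) ->
  grad phi x = q.
Proof.
move=> n0 hphi r0 hq; apply/eqP; rewrite -subr_eq0; apply/negPn/negP => v0.
set v := grad phi x - q in v0.
have [C' [r' [C0 r'0 h]]] := Cb2_taylor x n0 hphi.
have ev : 0 < enorm v by rewrite enorm_gt0.
pose c := `|C| + C' + 1.
have c0 : 0 < c by rewrite ltr_wpDl// addr_ge0.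
have Cc : C + C' < c by rewrite /c; have := ler_norm C; lra.
pose t := Num.min c^-1 (Num.min r r' / (2 * enorm v)).
have t0 : 0 < t by rewrite lt_min invr_gt0 c0 divr_gt0 ?mulr_gt0 ?lt_min ?r0.
have tc : t * c <= 1 by rewrite -ler_pdivlMr// div1r ge_min lexx.
have tr : enorm (t *: v) < Num.min r r'.
  rewrite enormZ gtr0_norm//.
  have : t * (2 * enorm v) <= Num.min r r'.
    by rewrite -ler_pdivlMr ?mulr_gt0// ge_min lexx orbT.
  have : 0 < t * enorm v by rewrite mulr_gt0.
  by rewrite mulrCA; set a := t * _; set b := Num.min _ _; lra.
move: tr; rewrite lt_min => /andP[tr tr'].
have := hq _ tr; have := h _ tr'; rewrite ler_norml => /andP[h1 _] h2.
have : dotmul v (t *: v) <= (C + C') * enorm (t *: v) ^+ 2.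
  by rewrite /v dotmulDl dotmulNl -/v; lra.
rewrite dotmulZr -sqr_enorm enormZ gtr0_norm// exprMn.
set N := enorm v ^+ 2; have N0 : 0 < t * N by rewrite mulr_gt0// exprn_gt0.
have ct : (C + C') * t < 1.
  by apply: lt_le_trans tc; rewrite mulrC ltr_pM2l.
have : (C + C') * t * (t * N) < t * N by rewrite gtr_pMl.
by rewrite expr2; lra.
Qed.

Lemma grad_oppr phi x : (forall i, derivable phi x (delta_mx ord0 i)) ->
  grad (fun y => - phi y) x = - grad phi x.
Proof. by move=> d; apply/rowP => i; rewrite !mxE deriveN. Qed.

Lemma Cb2_opp phi : Cb2 phi -> Cb2 (fun y => - phi y).
Proof.
move=> [[M [Mr hM]] h]; split.
  by exists M; split => // a /hM h' y hy; rewrite /= normrN; exact: h'.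
move=> i; have [d l] := h i; split => [x|x]; first exact: derivableN.
have dN y : 'D_(delta_mx ord0 i) (fun y => - phi y) y = - 'D_(delta_mx ord0 i) phi y.
  exact: deriveN.
have [U xU [M' [M'r hM']]] := l x; exists U => //; exists M'; split => // a /hM' h' y hy.
by have := h' y hy; rewrite /= !dN -opprD normrN.
Qed.

End taylor.

(** * The barrier function *)

Section powers.
Context (R : realType).
Implicit Types (a b d t u x al : R).

(** With t = exp u, apply 1 + s <= exp s to s = (1 - al) u and to s = - al u, and add the results
    with the weights [al] and [1 - al]: the terms in [u] cancel. *)
Lemma powR_le_tangent1 al t : 0 < al < 1 -> 0 <= t -> t `^ al <= 1 - al + al * t.
Proof.
move=> /andP[al0 al1]; rewrite le_eqVlt => /predU1P[<-|t0].
  by rewrite powR0 ?gt_eqF// mulr0 addr0 subr_ge0 ltW.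
rewrite /powR gt_eqF//; set u := ln t.
have -> : t = expR u by rewrite lnK.
have h1 : expR (al * u) * (1 + (u - al * u)) <= expR u.
  rewrite -[in leRHS](subrK (al * u) u) expRD [leRHS]mulrC.
  by apply: ler_wpM2l; [exact: expR_ge0|exact: expR_ge1Dx].
have h2 : expR (al * u) * (1 - al * u) <= 1.
  rewrite -[leRHS]expR0 -[in leRHS](subrr (al * u)) expRD.
  by apply: ler_wpM2l; [exact: expR_ge0|exact: expR_ge1Dx].
have h1' := ler_wpM2l (ltW al0) h1.
have al1' : 0 <= 1 - al by rewrite subr_ge0 ltW.
have h2' := ler_wpM2l al1' h2.
move: h1' h2'; set E := expR (al * u); set F := expR u; lra.
Qed.

(** The last hypothesis says that the tangent at [d] is still nonnegative at [x], so that it also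
    dominates the positive part where [x <= 0]. *)
Lemma powR_le_tangent al d x : 0 < al < 1 -> 0 < d -> - ((1 - al) * d) <= al * x ->
  Num.max x 0 `^ al <= d `^ al + al * d `^ (al - 1) * (x - d).
Proof.
move=> al01 d0 hx; have [al0 al1] := andP al01.
have E : d `^ al = d * d `^ (al - 1) by rewrite mulr_powRB1// ltW.
have p0 : 0 < d `^ (al - 1) by exact: powR_gt0.
have [x0|x0] := leP x 0.
  rewrite powR0 ?gt_eqF// E.
  have -> : d * d `^ (al - 1) + al * d `^ (al - 1) * (x - d) =
    d `^ (al - 1) * (d - al * d + al * x) by ring.
  by rewrite mulr_ge0 ?(ltW p0)//; lra.
rewrite -[x in x `^ al](divfK (lt0r_neq0 d0)) powRM ?divr_ge0 ?(ltW d0) ?(ltW x0)//.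
have := powR_le_tangent1 al01 (divr_ge0 (ltW x0) (ltW d0)).
move=> /(ler_wpM2r (powR_ge0 d al)) /le_trans; apply.
rewrite {1}E le_eqVlt; apply/orP; left; apply/eqP; rewrite E; field.
by rewrite gt_eqF.
Qed.

(** A share c / (a + b) lies in [0, 1], hence is at most its own power [al], and the two shares add
    up to 1. *)
Lemma powR_subadd al a b : 0 < al < 1 -> 0 <= a -> 0 <= b ->
  (a + b) `^ al <= a `^ al + b `^ al.
Proof.
move=> /andP[al0 al1] a0 b0.
have := addr_ge0 a0 b0; rewrite le_eqVlt => /predU1P[s0|s0].
  by rewrite -s0 powR0 ?gt_eqF// addr_ge0 ?powR_ge0.
have key c : 0 <= c -> c <= a + b -> (a + b) `^ al * (c / (a + b)) <= c `^ al.
  rewrite le_eqVlt => /predU1P[<- _|c0 cs]; first by rewrite mul0r mulr0 powR_ge0.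
  rewrite -[c in leRHS](divfK (lt0r_neq0 s0)) powRM ?divr_ge0 ?(ltW s0) ?(ltW c0)//.
  rewrite [leRHS]mulrC ler_wpM2l ?powR_ge0// ger1_powR ?(ltW al1)//.
  by rewrite divr_gt0//= ler_pdivrMr// mul1r.
have := key a a0; have := key b b0; rewrite lerDl lerDr => /(_ a0) h1 /(_ b0) h2.
apply: le_trans (lerD h2 h1); rewrite -mulrDr -mulrDl divff ?mulr1//.
exact: lt0r_neq0.
Qed.

End powers.

Section bump.
Context (R : realType) (n : nat) (n0 : (0 < n)%N).
Implicit Types (x y z p q : 'rV[R]_n).

(** This is the expansion of (|x + z| - |x|)^2 >= 0. The bound is valid for every [z], and its
    quadratic term is the curvature of the sphere through [x]. *)
Lemma enorm_addr_le x z : 0 < enorm x ->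
  enorm (x + z) <= enorm x + dotmul ((enorm x)^-1 *: x) z
                   + enorm z ^+ 2 / (2 * enorm x).
Proof.
move=> x0; have e0 : 0 < 2 * enorm x by rewrite mulr_gt0.
rewrite -(ler_pM2l e0) dotmulZl.
have -> : 2 * enorm x * (enorm x + (enorm x)^-1 * dotmul x z
    + enorm z ^+ 2 / (2 * enorm x)) =
    2 * enorm x ^+ 2 + 2 * dotmul x z + enorm z ^+ 2.
  by field; rewrite gt_eqF.
have : enorm (x + z) ^+ 2 = enorm x ^+ 2 + 2 * dotmul x z + enorm z ^+ 2.
  by rewrite !sqr_enorm !(dotmulDl, dotmulDr) (dotmulC z x); ring.
have := sqr_ge0 (enorm (x + z) - enorm x); rewrite sqrrB.
by lra.
Qed.

Definition bump (al : R) p (r : R) z : R := Num.max (enorm (z - p) - r) 0 `^ al.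

Lemma bump_ge0 al p r z : 0 <= bump al p r z.
Proof. exact: powR_ge0. Qed.

Lemma bump_out al p r y : 0 <= enorm (y - p) - r ->
  bump al p r y = (enorm (y - p) - r) `^ al.
Proof. by move=> h; rewrite /bump max_l. Qed.

Lemma bumpD al p r y z : 0 < al < 1 ->
  bump al p r (y + z) <= bump al p r y + enorm z `^ al.
Proof.
move=> al01; have /andP[al0 _] := al01.
have m0 (t : R) : 0 <= Num.max t 0 by rewrite le_max lexx orbT.
apply: le_trans (powR_subadd al01 (m0 _) (enorm_ge0 z)).
apply: ge0_ler_powR; rewrite ?(ltW al0) ?nnegrE ?addr_ge0 ?enorm_ge0//.
rewrite ge_max addr_ge0 ?enorm_ge0// andbT.
apply: (@le_trans _ _ (enorm (y - p) - r + enorm z)).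
  by have := enormD (y - p) z; rewrite (addrAC y); lra.
by rewrite lerD2r le_max lexx.
Qed.

Lemma bump_continuous al p r : 0 < al < 1 -> continuous (bump al p r).
Proof.
move=> al01 x; apply/(continuous_enormP _ _ n0) => e e0.
have /andP[al0 _] := al01.
exists (e `^ al^-1); first exact: powR_gt0.
move=> y yx.
have ye : enorm (y - x) `^ al < e.
  rewrite -[ltRHS](powRr1 (ltW e0)) -(mulVf (lt0r_neq0 al0)) powRrM.
  by rewrite gt0_ltr_powR// nnegrE ?enorm_ge0 ?powR_ge0.
have := @bumpD al p r x (y - x) al01; have := @bumpD al p r y (x - y) al01.
rewrite !subrKC (enormB x) => h1 h2; rewrite ltr_norml.
by move: h1 h2 ye; clear; lra.
Qed.

Section local.
Variables (al : R) (p y : 'rV[R]_n) (r : R).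
Hypotheses (al01 : 0 < al < 1) (r0 : 0 < r).
Local Notation d := (enorm (y - p) - r).
Hypothesis d0 : 0 < d.

(** The gradient of the bump at [y] as the chain rule gives it; it enters only through one-sided
    inequalities such as [bump_near]. *)
Definition bump_grad : 'rV[R]_n := (al * d `^ (al - 1)) *: ((enorm (y - p))^-1 *: (y - p)).

Let al0 : 0 < al. Proof. by have /andP[] := al01. Qed.
Let al1 : al < 1. Proof. by have /andP[] := al01. Qed.

Let yp0 : 0 < enorm (y - p).
Proof. by move: d0; rewrite subr_gt0; exact: lt_trans. Qed.

Let dge : 0 <= d. Proof. exact: ltW. Qed.

Lemma enorm_bump_grad : enorm bump_grad = al * d `^ (al - 1).
Proof.
rewrite /bump_grad !enormZ (gtr0_norm (x := (enorm _)^-1)) ?invr_gt0//.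
by rewrite mulVf ?gt_eqF// mulr1 ger0_norm// mulr_ge0 ?powR_ge0 ?(ltW al0).
Qed.

(** Concavity gives a tangent bound up to the radius d / al, far beyond the distance d to the
    exterior ball. This is what permits choosing [al] after the near-field radius N d. *)
Lemma bump_le_tangent z : al * enorm z <= d ->
  bump al p r (y + z) <= bump al p r y
    + al * d `^ (al - 1) * (enorm (y + z - p) - enorm (y - p)).
Proof.
move=> hz; rewrite (@bump_out _ _ _ y dge) /bump.
have -> : enorm (y + z - p) - enorm (y - p) = enorm (y + z - p) - r - d by ring.
apply: powR_le_tangent => //.
have h : d - enorm z <= enorm (y + z - p) - r.
  have := enorm_lerB (y - p) (- z); rewrite opprK enormN addrAC => h.
  by rewrite -addrA; lra.
apply: le_trans (ler_wpM2l (ltW al0) h); lra.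
Qed.

Lemma bump_near0 z : al * enorm z <= d ->
  bump al p r (y + z) - bump al p r y <= al * d `^ (al - 1) * enorm z.
Proof.
move=> /bump_le_tangent h; rewrite lerBlDl; apply: le_trans h _.
rewrite lerD2l ler_wpM2l ?mulr_ge0 ?powR_ge0 ?(ltW al0)//.
by have := enormD (y - p) z; rewrite addrAC; lra.
Qed.

Lemma bump_near z : al * enorm z <= d ->
  bump al p r (y + z) - bump al p r y - dotmul bump_grad z
    <= al * d `^ (al - 2) * enorm z ^+ 2.
Proof.
move=> /bump_le_tangent h.
have c0 : 0 <= al * d `^ (al - 1) by rewrite mulr_ge0 ?powR_ge0 ?(ltW al0).
have := enorm_addr_le z yp0; rewrite addrAC => h2.
have {}h2 : enorm (y + z - p) - enorm (y - p) <=
    dotmul ((enorm (y - p))^-1 *: (y - p)) z + enorm z ^+ 2 / (2 * enorm (y - p)).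
  by move: h2; lra.
rewrite {1}/bump_grad dotmulZl; have h3 := ler_wpM2l c0 h2.
have h4 : al * d `^ (al - 1) * (enorm z ^+ 2 / (2 * enorm (y - p))) <=
    al * d `^ (al - 2) * enorm z ^+ 2.
  have -> : d `^ (al - 1) = d `^ (al - 2) * d.
    rewrite -[X in _ = _ * X](powRr1 dge) -powRD; first by congr (_ `^ _); lra.
    by apply/implyP => _; rewrite gt_eqF.
  rewrite -[leLHS]mulrA -(mulrA (d `^ _)) -[leRHS]mulrA ler_wpM2l ?(ltW al0)//.
  rewrite ler_wpM2l ?powR_ge0// mulrCA ler_piMr ?sqr_ge0//.
  rewrite ler_pdivrMr ?mulr_gt0// mul1r.
  by move: yp0 r0; lra.
by move: h h3 h4; lra.
Qed.

(* The cone condition of the boundary nondegeneracy puts [y + z] so close to the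
   exterior ball that the bump loses half of its value. *)
Lemma bump_cone z C : 0 <= C ->
  dotmul z ((enorm (y - p))^-1 *: (y - p)) <= - d -> enorm z <= C * d ->
  C ^+ 2 * d / (2 * r) <= 2^-1 `^ al^-1 ->
  bump al p r (y + z) - bump al p r y <= - (d `^ al / 2).
Proof.
move=> C0 hz zC hC; rewrite (@bump_out _ _ _ y dge).
suff : bump al p r (y + z) <= d `^ al / 2 by lra.
(* The linear term cancels all of d; what is left is the curvature error, at most C^2 d^2 / (2
   r). *)
have h : enorm (y + z - p) - r <= 2^-1 `^ al^-1 * d.
  have := enorm_addr_le z yp0; rewrite addrAC dotmulC => h2.
  have h3 : enorm z ^+ 2 / (2 * enorm (y - p)) <= C ^+ 2 * d / (2 * r) * d.
    rewrite (_ : C ^+ 2 * d / (2 * r) * d = (C * d) ^+ 2 / (2 * r)); last by ring.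
    rewrite ler_pM ?sqr_ge0 ?invr_ge0 ?mulr_ge0 ?enorm_ge0//.
      by rewrite lerXn2r ?nnegrE ?mulr_ge0 ?enorm_ge0 ?(ltW d0).
    by rewrite lef_pV2 ?posrE ?mulr_gt0//; move: d0; lra.
  have := ler_wpM2r (ltW d0) hC; lra.
have -> : d `^ al / 2 = (2^-1 `^ al^-1 * d) `^ al.
  rewrite powRM ?powR_ge0 ?(ltW d0)// -powRrM mulVf ?gt_eqF// powRr1 ?invr_ge0//.
  by rewrite mulrC.
apply: ge0_ler_powR; rewrite ?(ltW al0) ?nnegrE ?le_max ?lexx ?orbT ?mulr_ge0 ?powR_ge0 ?(ltW d0)//.
by rewrite ge_max h mulr_ge0 ?powR_ge0 ?(ltW d0).
Qed.

End local.
End bump.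

(** * Integrability of the second differences *)

Section exponents.
Context (R : realType) (sigma : R) (hs : 0 < sigma < 2).

(* [z `^ near_exp] is integrable against the kernel near the origin,
   [z `^ far_exp] away from it. *)
Definition near_exp : R := if sigma < 1 then 1 else 2.
Definition far_exp : R := if 1 < sigma then 1 else sigma / 2.

Lemma near_exp_gt0 : 0 < near_exp.
Proof. by rewrite /near_exp; case: ifP. Qed.

Lemma near_exp_gt : sigma < near_exp.
Proof. by rewrite /near_exp; case: ifP => //; have /andP[] := hs. Qed.

Lemma far_exp_gt0 : 0 < far_exp.
Proof. by rewrite /far_exp; case: ifP => // _; move: hs; lra. Qed.

Lemma far_exp_lt : far_exp < sigma.
Proof. by rewrite /far_exp; case: ifP => // _; move: hs; lra. Qed.

End exponents.

Section integrability.
Context (R : realType) (n : nat) (n0 : (0 < n)%N) (sigma Lam : R).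
Hypothesis hs : 0 < sigma < 2.
Local Notation leb := (@lebesgue_rV R n).
Context (K : 'rV[R]_n -> R) (hK : kernel_upper_bounds sigma Lam K).
Implicit Types (phi : 'rV[R]_n -> R) (x z q : 'rV[R]_n).

Definition near_pow (r : R) z : R := enorm z `^ near_exp sigma * \1_(eball 0 r) z.
Definition far_pow (r : R) z : R := enorm z `^ far_exp sigma * \1_(~` eball 0 r) z.

Lemma near_powE r z : enorm z < r -> near_pow r z = enorm z `^ near_exp sigma.
Proof.
by move=> h; rewrite /near_pow indicE mem_set ?mulr1// /eball/= subr0.
Qed.

Lemma near_pow0 r z : r <= enorm z -> near_pow r z = 0.
Proof.
by move=> h; rewrite /near_pow indicE memNset ?mulr0// /eball/= subr0; apply/negP; rewrite -leNgt.
Qed.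

Lemma far_powE r z : r <= enorm z -> far_pow r z = enorm z `^ far_exp sigma.
Proof.
move=> h; rewrite /far_pow indicE mem_set ?mulr1// /eball/= subr0.
by apply/negP; rewrite -leNgt.
Qed.

Lemma far_pow0 r z : enorm z < r -> far_pow r z = 0.
Proof.
by move=> h; rewrite /far_pow indicE memNset ?mulr0// /eball/= subr0; exact.
Qed.

Lemma far_pow_ge0 r z : 0 <= far_pow r z.
Proof. by rewrite mulr_ge0 ?powR_ge0// indicE. Qed.

Lemma integrable_near_pow r : 0 < r ->
  leb.-integrable setT (EFin \o (fun z => near_pow r z * K z)).
Proof.
move=> r0; have [C _ h] := near_moment n0 Lam (near_exp_gt0 _) (near_exp_gt hs).
exact: (h K r hK r0).1.
Qed.

Lemma integrable_far_pow r : 0 < r ->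
  leb.-integrable setT (EFin \o (fun z => far_pow r z * K z)).
Proof.
move=> r0; have [C _ h] := far_moment n0 Lam (far_exp_gt0 hs) (far_exp_lt hs).
exact: (h K r hK r0).1.
Qed.

Lemma integrableZl_EFin (c : R) (f : 'rV[R]_n -> R) :
  leb.-integrable setT (EFin \o f) -> leb.-integrable setT (EFin \o (fun z => c * f z)).
Proof.
move=> h; rewrite (_ : _ \o _ = (fun z => c%:E * (EFin \o f) z)%E).
  exact: integrableZl.
by apply/funext => z; rewrite /= EFinM.
Qed.

Lemma integrableD_EFin (f g : 'rV[R]_n -> R) :
  leb.-integrable setT (EFin \o f) -> leb.-integrable setT (EFin \o g) ->
  leb.-integrable setT (EFin \o (fun z => f z + g z)).
Proof.
move=> hf hg; rewrite (_ : _ \o _ = (EFin \o f) \+ (EFin \o g))%E.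
  exact: integrableD.
by apply/funext => z; rewrite /= EFinD.
Qed.

Lemma integrable_of_pow r A1 A2 (f : 'rV[R]_n -> R) : 0 < r ->
  measurable_fun [set: lebesgueT R n] f ->
  (forall z, `|f z| <= A1 * near_pow r z + A2 * far_pow r z) ->
  leb.-integrable setT (EFin \o (fun z => f z * K z)).
Proof.
move=> r0 mf hf.
apply: (@le_integrable _ _ _ leb setT measurableT _
  (EFin \o (fun z => A1 * (near_pow r z * K z) + A2 * (far_pow r z * K z)))).
- apply/measurable_EFinP; apply: measurable_funM => //.
  exact: measurable_kernel hK.
- move=> z _; rewrite /= lee_fin normrM (ger0_norm (kernel_ge0 hK z)).
  apply: le_trans (ler_norm _); rewrite (mulrA A1) (mulrA A2) -mulrDl.
  by apply: ler_wpM2r => //; exact: (kernel_ge0 hK).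
apply: (@integrableD_EFin (fun z => A1 * (near_pow r z * K z))
  (fun z => A2 * (far_pow r z * K z))); apply: (@integrableZl_EFin _ (fun z => _ * K z)).
  exact: integrable_near_pow.
exact: integrable_far_pow.
Qed.

Lemma measurable_dotmul q : measurable_fun [set: lebesgueT R n] (dotmul q).
Proof.
apply: continuous_measurable_lebesgueT => x; apply/(continuous_enormP _ _ n0) => e e0.
have q0 : 0 < enorm q + 1 by rewrite ltr_wpDl// enorm_ge0.
exists (e / (enorm q + 1)); first by rewrite divr_gt0.
move=> y; rewrite ltr_pdivlMr// => h; rewrite -dotmulNr -dotmulDr.
apply: le_lt_trans (cauchy_schwarz _ _) _; apply: le_lt_trans h.
by rewrite mulrC ler_wpM2l ?enorm_ge0// lerDl.
Qed.

Lemma measurable_delta phi x : continuous phi ->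
  measurable_fun [set: lebesgueT R n] (delta sigma phi x).
Proof.
move=> cphi.
have m1 : measurable_fun [set: lebesgueT R n] (fun z : 'rV[R]_n => phi (x + z) - phi x).
  apply: measurable_funB; last exact: measurable_cst.
  apply: continuous_measurable_lebesgueT => z.
  apply/(continuous_enormP _ _ n0) => e e0.
  have [d d0 h] := (continuous_enormP phi (x + z) n0).1 (cphi _) e e0.
  by exists d => // y yz; apply: h; rewrite opprD [X in enorm X]addrACA subrr add0r.
rewrite /delta; case: (sigma < 1); first exact: m1.
case: (sigma == 1); apply: measurable_funB; [exact: m1| |exact: m1|exact: measurable_dotmul].
apply: measurable_funM; last exact: measurable_dotmul.
by apply: measurable_indic; exact: measurable_eball.
Qed.

Lemma integrable_delta phi x : Cb2 phi ->
  leb.-integrable setT (EFin \o (fun z => delta sigma phi x z * K z)).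
Proof.
move=> hphi; have [C [r' [C0 r'0 hC]]] := Cb2_taylor x n0 hphi.
have [[M0 [M0r hM]] _] := hphi.
pose M := `|M0| + 1.
have {}hM z : `|phi z| <= M.
  by apply: (hM M) => //; rewrite (le_lt_trans (ler_norm _))// ltrDl.
have M0' : 0 <= M by rewrite addr_ge0.
(* Below radius 1 the quadratic Taylor error is at most linear, as needed for [sigma < 1], and the
   cut-off in [delta] at [sigma = 1] equals 1. *)
pose r := Num.min r' 1.
have r0 : 0 < r by rewrite lt_min r'0 ltr01.
have r1 : r <= 1 by rewrite ge_min lexx orbT.
pose G := enorm (grad phi x); have G0 : 0 <= G by exact: enorm_ge0.
have hG z := cauchy_schwarz (grad phi x) z.
have hM2 z : `|phi (x + z) - phi x| <= 2 * M.
  by apply: le_trans (ler_normB _ _) _; have := hM (x + z); have := hM x; lra.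
pose P := r `^ (- far_exp sigma).
have P0 : 0 <= P by exact: powR_ge0.
apply: (@integrable_of_pow r (C + G) ((2 * M + G) * P) _ r0).
  exact/measurable_delta/Cb2_continuous.
move=> z; have z0 := enorm_ge0 z.
have far_ge : r <= enorm z -> 1 <= P * far_pow r z.
  move=> rz; rewrite far_powE// /P powRN mulrC ler_pdivlMr ?powR_gt0// mul1r.
  by apply: ge0_ler_powR; rewrite ?nnegrE ?(ltW (far_exp_gt0 hs)) ?(ltW r0).
have far_ge1 : 1 < sigma -> r <= enorm z -> enorm z <= P * far_pow r z.
  move=> s1 rz; rewrite far_powE// /P /far_exp s1 powRr1// powR_inv1 ?(ltW r0)//.
  by rewrite ler_peMl// invf_ge1.
have near1 : enorm z < r -> `|phi (x + z) - phi x - dotmul (grad phi x) z| <= C * enorm z ^+ 2.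
  by move=> zr; apply: hC; apply: lt_le_trans zr _; rewrite ge_min lexx.
have [zr|rz] := ltP (enorm z) r.
  rewrite (far_pow0 zr) mulr0 addr0 (near_powE zr).
  have z1 : enorm z < 1 by exact: lt_le_trans zr r1.
  have {}near1 := near1 zr.
  have sq : enorm z ^+ 2 <= enorm z by rewrite expr2 ler_piMl// ltW.
  have near2 : C * enorm z ^+ 2 <= (C + G) * enorm z `^ 2.
    by rewrite powR_mulrn// ler_wpM2r ?sqr_ge0// lerDl.
  rewrite /delta /near_exp; case: ifPn => [s1|s1].
    rewrite powRr1// mulrDl.
    rewrite -(subrK (dotmul (grad phi x) z) (phi _ - _)).
    apply: le_trans (ler_normD _ _) _; apply: lerD => //.
    by apply: le_trans near1 _; rewrite ler_wpM2l.
  case: ifPn => [_|_]; last exact: le_trans near1 near2.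
  rewrite indicE mem_set ?mul1r; first exact: le_trans near1 near2.
  by rewrite /eball/= subr0.
rewrite (near_pow0 rz) mulr0 add0r -mulrA.
have {}far_ge := far_ge rz; set T := P * _ in far_ge far_ge1 *.
have T2 : 2 * M <= 2 * M * T by rewrite ler_peMr// mulr_ge0.
rewrite /delta; case: ifPn => s1.
  apply: le_trans (hM2 z) _; apply: le_trans T2 _.
  by rewrite ler_wpM2r ?lerDl// (le_trans ler01).
case: ifPn => s2; rewrite mulrDl; apply: le_trans (ler_normB _ _) _; apply: lerD.
- exact: le_trans (hM2 z) T2.
- rewrite indicE /eball/= /mem /in_mem/= /in_set; case: asboolP => /=; rewrite subr0 => z1.
    rewrite mul1r; apply: le_trans (hG z) _; rewrite ler_wpM2l//.
    exact: le_trans (ltW z1) far_ge.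
  by rewrite mul0r normr0 mulr_ge0// (le_trans ler01).
- exact: le_trans (hM2 z) T2.
apply: le_trans (hG z) _; rewrite ler_wpM2l//; apply: far_ge1 => //.
by rewrite lt_def s2 leNgt.
Qed.

End integrability.

(** * Cancellation of the gradient term for sigma = 1 *)

Section shell_cancellation.
Context (R : realType) (n : nat) (n0 : (0 < n)%N) (Lam : R).
Local Notation leb := (@lebesgue_rV R n).
Context (K : 'rV[R]_n -> R) (hK : kernel_upper_bounds 1 Lam K).
Implicit Types (z q : 'rV[R]_n).

(* For [sigma = 1] the first moment over each dyadic annulus vanishes; hence so
   does the moment over [shell r] when [r] is a power of 1/2, which disposes
   of the gradient term between the radii [r] and 1. *)
Definition shell (r : R) : set 'rV[R]_n := [set z | r <= enorm z < 1].

Lemma measurable_shell r : measurable (shell r : set (lebesgueT R n)).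
Proof.
rewrite (_ : shell r = eball 0 1 `\` eball 0 r).
  by apply: measurableD; exact: measurable_eball.
apply/seteqP; split => z; rewrite /shell /eball /setD /= subr0.
  by move=> /andP[h1 ->]; split => //; apply/negP; rewrite -leNgt.
by move=> [-> /negP]; rewrite -leNgt => ->.
Qed.

Lemma integrable_shell q (r : R) (D : set 'rV[R]_n) : 0 < r ->
  measurable (D : set (lebesgueT R n)) -> D `<=` shell r ->
  leb.-integrable setT (EFin \o (fun z => \1_D z * dotmul q z * K z)).
Proof.
move=> r0 mD Dr; have hs : 0 < (1 : R) < 2 by rewrite ltr01 ltr1n.
apply: (integrable_of_pow (r := r) (A1 := 0) (A2 := enorm q) n0 hs hK r0).
  apply: measurable_funM; last exact: measurable_dotmul.
  exact: measurable_indic.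
move=> z; rewrite mul0r add0r indicE.
have [zD|zD] := boolP (z \in D); last first.
  by rewrite mul0r normr0 mulr_ge0 ?far_pow_ge0 ?enorm_ge0.
have /andP[rz z1] := Dr _ (set_mem zD).
rewrite mul1r far_powE//; apply: le_trans (cauchy_schwarz _ _) _.
(* At [sigma = 1] the exponent [far_exp] is 1/2, and |z| <= |z|^(1/2) because |z| < 1 on the
   shell. *)
rewrite ler_wpM2l ?enorm_ge0// /far_exp ltxx div1r ger1_powR//.
  by rewrite (lt_le_trans r0 rz) ltW.
by rewrite invf_le1// ler1n.
Qed.

(** Integrability is kept together with the zero integral so that the property is closed under
    sums. *)
Definition null_integrable (f : 'rV[R]_n -> R) : Prop :=
  leb.-integrable setT (EFin \o f) /\ \int[leb]_z f z = 0.

Lemma null_integrable0 : null_integrable (fun=> 0).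
Proof.
split; last by rewrite /Rintegral integral0.
exact: (@integrable0 _ _ _ leb setT).
Qed.

Let null_integrableD f g : null_integrable f -> null_integrable g ->
  null_integrable (fun z => f z + g z).
Proof.
move=> [f1 f2] [g1 g2]; split; first exact: integrableD_EFin.
by rewrite RintegralD// f2 g2 addr0.
Qed.

Let null_integrableZ c f : null_integrable f -> null_integrable (fun z => c * f z).
Proof.
move=> [f1 f2]; split; first exact: integrableZl_EFin.
by rewrite RintegralZl// f2 mulr0.
Qed.

Let null_integrable_annulus j i :
  null_integrable (fun z => \1_(shell (2^-1 ^+ j.+1) `&` ~` shell (2^-1 ^+ j)) z * z ord0 i * K z).
Proof.
set D := _ `&` _.
have t0 k : 0 < 2^-1 ^+ k :> R by rewrite exprn_gt0// invr_gt0.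
have mD : measurable (D : set (lebesgueT R n)).
  by apply: measurableI; [|apply: measurableC]; exact: measurable_shell.
split.
  have := @integrable_shell (delta_mx ord0 i) _ D (t0 j.+1) mD (@subIsetl _ _ _).
  congr (integrable _ _ _); apply/funext => z; rewrite /= dotmulC dotmul_delta//.
have [_ _ /(_ _ (t0 j.+1)) [_ hz]] := hK.
move: hz; rewrite subrr normr0 mulr0 mul0r => hz.
have /enorm_eq0/rowP/(_ i) :
    enorm (\row_i \int[leb]_(z in @annulus R n (2^-1 ^+ j.+1)) (z ord0 i * K z)) = 0.
  by apply/eqP; rewrite eq_le enorm_ge0 hz.
rewrite !mxE => <-; rewrite /Rintegral [in RHS]integral_mkcond.
congr fine; apply: eq_integral => z _; rewrite patchE indicE.
have -> : (z \in D) = (z \in @annulus R n (2^-1 ^+ j.+1)).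
  apply/idP/idP; rewrite !inE.
    move=> [/andP[h1 h2] /negP h3]; apply/annulusP; rewrite h1/=.
    rewrite exprS mulrA divff// mul1r ltNge; apply: contra h3 => ->; exact: h2.
  move=> /annulusP/andP[h1]; rewrite exprS mulrA divff// mul1r => h2; split.
    by rewrite /shell/= h1; apply: lt_le_trans h2 _; rewrite exprn_ile1 ?invr_ge0// invf_le1// ler1n.
  by rewrite /shell/= leNgt h2.
by case: ifP; rewrite ?mul1r ?mul0r.
Qed.

Lemma shell_cancel q m : null_integrable (fun z => \1_(shell (2^-1 ^+ m)) z * dotmul q z * K z).
Proof.
have hi m' i : null_integrable (fun z => \1_(shell (2^-1 ^+ m')) z * z ord0 i * K z).
  elim: m' => [|j ih].
    rewrite (_ : (fun _ => _) = fun=> 0); first exact: null_integrable0.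
    apply/funext => z; rewrite indicE memNset ?mul0r// /shell/= expr0 => /andP[h1 h2].
    by have := le_lt_trans h1 h2; rewrite ltxx.
  have := null_integrableD ih (null_integrable_annulus j i); congr null_integrable.
  apply/funext => z.
  rewrite -!mulrDl !indicE; congr (_ * _ * _).
  rewrite in_setI in_setC.
  have [zj|zj] := boolP (z \in shell (2^-1 ^+ j)); last by rewrite andbT add0r.
  rewrite andbF addr0 mem_set//; move: zj; rewrite inE /shell/= => /andP[h1 ->].
  rewrite andbT; apply: le_trans h1; rewrite exprS ler_piMl ?exprn_ge0 ?invr_ge0//.
  by rewrite invf_le1// ler1n.
rewrite (_ : (fun z => _) = fun z =>
  \sum_(i < n) q ord0 i * (\1_(shell (2^-1 ^+ m)) z * z ord0 i * K z)); last first.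
  apply/funext => z; rewrite /dotmul mulr_sumr mulr_suml; apply: eq_bigr => i _; ring.
have : forall s : seq 'I_n, null_integrable (fun z =>
  \sum_(i <- s) q ord0 i * (\1_(shell (2^-1 ^+ m)) z * z ord0 i * K z)).
  elim => [|i s ih].
    rewrite (_ : (fun _ => _) = fun=> 0); first exact: null_integrable0.
    by apply/funext => z; rewrite big_nil.
  have := null_integrableD (null_integrableZ (q ord0 i) (hi m i)) ih; congr null_integrable.
  by apply/funext => z; rewrite big_cons.
by move=> /(_ (index_enum 'I_n)).
Qed.

End shell_cancellation.

(** * Pointwise bound on the second differences *)

Section bump_pointwise.
Context (R : realType) (n : nat) (n0 : (0 < n)%N) (sigma : R).
Hypothesis hs : 0 < sigma < 2.
Implicit Types (phi : 'rV[R]_n -> R) (x z : 'rV[R]_n).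

(** The coefficient of the gradient term in [delta]; it puts the three ranges of [sigma] into one
    formula. *)
Definition delta_cutoff z : R :=
  if sigma < 1 then 0 else if sigma == 1 then \1_(eball 0 1) z else 1.

Lemma deltaE phi x z :
  delta sigma phi x z = phi (x + z) - phi x - delta_cutoff z * dotmul (grad phi x) z.
Proof.
rewrite /delta /delta_cutoff; case: ifP => _; first by rewrite mul0r subr0.
by case: ifP => _ //; rewrite mul1r.
Qed.

Lemma delta_cutoff01 z : 0 <= delta_cutoff z <= 1.
Proof.
rewrite /delta_cutoff; case: ifP => _; first by rewrite lexx ler01.
by case: ifP => _; rewrite ?indicE ?ler01 ?lexx//; case: (_ \in _); rewrite ?lexx ?ler01.
Qed.

Variables (al : R) (p y : 'rV[R]_n) (r C N rho : R) (S : set 'rV[R]_n).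
Hypotheses (al01 : 0 < al < 1) (r0 : 0 < r).
Local Notation d := (enorm (y - p) - r).
Local Notation nu := ((enorm (y - p))^-1 *: (y - p)).
Local Notation q := (bump_grad al p y r).
Hypotheses (d0 : 0 < d) (C0 : 0 < C) (N1 : 1 <= N) (CN : C <= N)
  (rhoN : N * d <= rho <= 2 * N * d) (rho1 : rho <= 1)
  (alN : al * (2 * N) <= 1) (alC : al * C <= 4^-1) (als : al <= far_exp sigma)
  (hC : C ^+ 2 * d / (2 * r) <= 2^-1 `^ al^-1)
  (hS : S `<=` [set z | dotmul z nu < - d] `&` (eball 0 (C * d) `\` eball 0 d)).

Let al0 : 0 < al. Proof. by have /andP[] := al01. Qed.

(** On [S], which lies inside radius [rho] because [C <= N], the bump loses half of d^al and the
    gradient term returns at most a quarter ([alC]). Elsewhere inside [rho] the tangent bounds apply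
    ([alN]). Outside [rho] the increment is at most |z|^al, which is traded for |z|^far_exp since
    [al <= far_exp] and |z| >= d; the factor 2 leaves room for the gradient term when [sigma > 1].
    When [sigma = 1] that term is kept on the shell, to be integrated to zero. *)
Lemma bump_pointwise z :
  bump al p r (y + z) - bump al p r y - delta_cutoff z * dotmul q z <=
  al * d `^ (al - near_exp sigma) * near_pow sigma rho z
  + 2 * d `^ (al - far_exp sigma) * far_pow sigma rho z
  - d `^ al / 4 * \1_S z - (sigma == 1)%:R * (\1_(shell rho) z * dotmul q z).
Proof.
have z0 := enorm_ge0 z.
have /andP[rho_ge rho_le] := rhoN.
have Cd : C * d <= rho by apply: le_trans rho_ge; rewrite ler_wpM2r ?(ltW d0).
have eq_q := enorm_bump_grad al01 r0 d0.
have qz := cauchy_schwarz q z; rewrite eq_q ler_norml in qz.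
have /andP[qz1 _] := qz.
have da : d * d `^ (al - 1) = d `^ al by rewrite mulr_powRB1// ltW.
have dp : 0 < d `^ (al - 1) by exact: powR_gt0.
have /andP[chi0 chi1] := delta_cutoff01 z.
have [zr|rz] := ltP (enorm z) rho.
  rewrite (far_pow0 _ zr) mulr0 addr0 (near_powE _ zr).
  have -> : \1_(shell rho) z = 0 :> R.
    by rewrite indicE memNset// /shell/= => /andP[/le_lt_trans/(_ zr)]; rewrite ltxx.
  rewrite mul0r mulr0 subr0 indicE.
  have [zS|zS] := boolP (z \in S).
    have [h1 [h2 h3]] := hS (set_mem zS).
    move: h2; rewrite /eball/= subr0 => h2.
    have := bump_cone al01 r0 d0 (ltW C0) (ltW h1) (ltW h2) hC => hb.
    have hq : - (delta_cutoff z * dotmul q z) <= d `^ al / 4.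
      rewrite -mulrN.
      apply: (@le_trans _ _ (al * d `^ (al - 1) * enorm z)).
        apply: (@le_trans _ _ (delta_cutoff z * (al * d `^ (al - 1) * enorm z))).
          by rewrite ler_wpM2l// lerNl.
        by rewrite ler_piMl// !mulr_ge0// ?(ltW al0) ?(ltW dp).
      apply: (@le_trans _ _ (al * d `^ (al - 1) * (C * d))).
        by rewrite ler_wpM2l ?(ltW h2)// mulr_ge0 ?(ltW al0) ?(ltW dp).
      rewrite -da (_ : al * _ * _ = al * C * (d * d `^ (al - 1))); last by ring.
      by rewrite [leRHS]mulrC ler_wpM2r// mulr_ge0 ?(ltW d0) ?(ltW dp).
    have : 0 <= al * d `^ (al - near_exp sigma) * enorm z `^ near_exp sigma.
      by rewrite !mulr_ge0 ?powR_ge0 ?(ltW al0).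
    by move: hb hq; set a := d `^ al; rewrite mulr1; lra.
  rewrite mulr0 subr0.
  have alz : al * enorm z <= d.
    apply: (@le_trans _ _ (al * (2 * N * d))).
      by rewrite ler_wpM2l ?(ltW al0)// (le_trans (ltW zr)).
    by rewrite mulrA ler_piMl ?(ltW d0).
  rewrite /delta_cutoff /near_exp; case: ifP => s1.
    by rewrite mul0r subr0 powRr1//; exact: bump_near0.
  have -> : (if sigma == 1 then \1_(eball 0 1) z else 1) = 1 :> R.
    case: ifP => // _; rewrite indicE mem_set// /eball/= subr0.
    exact: lt_le_trans zr rho1.
  by rewrite mul1r powR_mulrn//; exact: bump_near.
rewrite (near_pow0 _ rz) mulr0 add0r (far_powE _ rz).
have -> : \1_S z = 0 :> R.
  rewrite indicE memNset// => /hS[_ [+ _]]; rewrite /eball/= subr0 => h.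
  by have := lt_le_trans h (le_trans Cd rz); rewrite ltxx.
rewrite mulr0 subr0.
have dz : d <= enorm z.
  by apply: le_trans rz; apply: le_trans rho_ge; rewrite ler_peMl ?(ltW d0).
have z00 : 0 < enorm z by exact: lt_le_trans dz.
set T := d `^ (al - far_exp sigma) * enorm z `^ far_exp sigma.
have hT : enorm z `^ al <= T.
  rewrite -[al in leLHS](subrK (far_exp sigma)) powRD; last first.
    by apply/implyP => _; rewrite gt_eqF.
  rewrite ler_wpM2r ?powR_ge0// -opprB !powRN lef_pV2 ?posrE ?powR_gt0//.
  by apply: ge0_ler_powR => //; rewrite ?nnegrE ?(ltW d0)// subr_ge0.
have hb : bump al p r (y + z) - bump al p r y <= T.
  by apply: le_trans hT; rewrite lerBlDl; exact: bumpD.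
have T0 : 0 <= T by rewrite mulr_ge0 ?powR_ge0.
rewrite -[2 * _ * _]mulrA -/T.
rewrite /delta_cutoff; case: ifPn => s1.
  by rewrite (lt_eqF s1) !mul0r !subr0; move: hb T0; lra.
case: ifPn => s2.
  rewrite mul1r; have -> : \1_(eball 0 1) z = \1_(shell rho) z :> R.
    rewrite !indicE; congr (_%:R); congr nat_of_bool; apply/idP/idP; rewrite !inE /eball /shell/= subr0.
      by move=> ->; rewrite rz.
    by case/andP.
  by move: hb T0; lra.
rewrite mul1r mul0r subr0.
have s3 : 1 < sigma by rewrite lt_def s2 leNgt.
have : al * d `^ (al - 1) * enorm z <= T.
  rewrite /T /far_exp s3 powRr1// ler_wpM2r// ler_piMl ?(ltW dp)//.
  by have /andP[_ /ltW] := al01.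
by move: qz1 hb T0; lra.
Qed.

Section touching.
Variables (phi : 'rV[R]_n -> R) (M : R).
Hypotheses (hphi : Cb2 phi) (M0 : 0 <= M).
Hypothesis touch : forall z,
  phi (y + z) - phi y <= M * (bump al p r (y + z) - bump al p r y).

(** Touching from below bounds the increments of [phi] by those of the bump, hence by a linear form
    plus a quadratic term, and [grad_eq_of_le] applies. *)
Lemma grad_touch : grad phi y = M *: q.
Proof.
apply: (@grad_eq_of_le _ _ phi y _ (M * (al * d `^ (al - 2))) d) => // z zd.
apply: le_trans (touch z) _; rewrite dotmulZl -mulrA -mulrDr ler_wpM2l//.
rewrite -lerBlDl; apply: bump_near => //; apply: le_trans (ltW zd).
by rewrite ler_piMl ?enorm_ge0//; have /andP[_ /ltW] := al01.
Qed.

Lemma delta_touch z : delta sigma phi y z <= M *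
  (al * d `^ (al - near_exp sigma) * near_pow sigma rho z
  + 2 * d `^ (al - far_exp sigma) * far_pow sigma rho z
  - d `^ al / 4 * \1_S z - (sigma == 1)%:R * (\1_(shell rho) z * dotmul q z)).
Proof.
apply: le_trans (ler_wpM2l M0 (bump_pointwise z)).
by rewrite deltaE grad_touch dotmulZl mulrCA mulrBr lerD2r.
Qed.

End touching.
End bump_pointwise.

(** * The integral estimate near the boundary *)

Section key_estimate.
Context (R : realType) (n : nat) (n0 : (0 < n)%N) (sigma Lam : R).
Hypothesis hs : 0 < sigma < 2.
Local Notation leb := (@lebesgue_rV R n).

(** Supplies a radius at which [shell_cancel] is available, within a factor 2 of a prescribed
    one. *)
Lemma dyadic_between (x : R) : 0 < x < 1 -> exists m, x / 2 <= 2^-1 ^+ m <= x.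
Proof.
move=> /andP[x0 x1].
have ex : exists m, 2^-1 ^+ m <= x.
  have := @truncnS_gt R x^-1; set m := Num.truncn _ => h; exists m.
  rewrite exprVn -[leRHS]invrK lef_pV2 ?posrE ?exprn_gt0 ?invr_gt0//.
  by apply: le_trans (ltW h) _; rewrite -natrX ler_nat ltn_expl.
have [[|m] hm hmin] := ex_minnP ex.
  by have := le_lt_trans hm x1; rewrite expr0 ltxx.
exists m.+1; rewrite hm andbT exprS mulrC ler_wpM2l ?invr_ge0//.
rewrite leNgt; apply/negP => /ltW/hmin; by rewrite ltnn.
Qed.

(** The lower bound d^(- n - sigma) of the kernel meets a volume of at least mu (2 / n)^n d^n, which
    leaves d^(- sigma). *)
Lemma kernel_mass_ge (K : 'rV[R]_n -> R) (S : set 'rV[R]_n) (d lam mu : R) :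
  kernel_upper_bounds sigma Lam K -> 0 < d -> 0 <= lam -> 0 <= mu ->
  measurable (S : set (lebesgueT R n)) -> S `<=` ~` eball 0 d ->
  (mu%:E * leb (eball 0 d) <= leb S)%E ->
  (forall z, S z -> (2 - sigma) * lam * d `^ (- n%:R - sigma) <= K z) ->
  leb.-integrable setT (EFin \o (fun z => \1_S z * K z)) /\
  (2 - sigma) * lam * mu * (2 / n%:R) ^+ n * d `^ (- sigma)
    <= \int[leb]_z (\1_S z * K z).
Proof.
move=> hK d0 lam0 mu0 mS Sd leS hSK.
have iS : leb.-integrable setT (EFin \o (fun z => \1_S z * K z)).
  apply: (integrable_of_pow (r := d) (A1 := 0) (A2 := d `^ (- far_exp sigma)) n0 hs hK d0).
    exact: measurable_indic.
  move=> z; rewrite mul0r add0r indicE.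
  have [zS|zS] := boolP (z \in S); last by rewrite normr0 mulr_ge0 ?powR_ge0 ?far_pow_ge0.
  have := Sd _ (set_mem zS); rewrite /eball/= subr0 => /negP; rewrite -leNgt => dz.
  rewrite normr1 far_powE// powRN mulrC ler_pdivlMr ?powR_gt0// mul1r.
  by apply: ge0_ler_powR => //; rewrite ?nnegrE ?(ltW (far_exp_gt0 hs)) ?(ltW d0) ?enorm_ge0.
split => //.
have s2 : 0 <= 2 - sigma by move: hs; lra.
pose c := (2 - sigma) * lam * d `^ (- n%:R - sigma).
have c0 : 0 <= c by rewrite !mulr_ge0 ?powR_ge0.
rewrite -lee_fin /Rintegral fineK; last exact: integrable_fin_num.
apply: (@le_trans _ _ (c%:E * leb S)%E).
  apply: (@le_trans _ _ (c%:E * (mu%:E * leb (eball 0 d)))%E); last first.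
    by apply: lee_wpmul2l => //; rewrite lee_fin.
  apply: (@le_trans _ _ (c%:E * (mu%:E * ((2 / n%:R) ^+ n * d ^+ n)%:E))%E); last first.
    apply: lee_wpmul2l; first by rewrite lee_fin.
    by apply: lee_wpmul2l; [rewrite lee_fin|exact: lebesgue_eball_ge].
  rewrite -!EFinM lee_fin /c.
  have -> : d `^ (- n%:R - sigma) = d `^ (- sigma) * (d ^+ n)^-1.
    rewrite addrC powRD; last by apply/implyP => _; rewrite gt_eqF.
    by rewrite [_ `^ (- n%:R)]powRN powR_mulrn// ltW.
  rewrite le_eqVlt; apply/orP; left; apply/eqP; field.
  by rewrite expf_neq0 ?gt_eqF.
have -> : leb S = (\int[leb]_z (\1_S z)%:E)%E.
  by rewrite integral_indic// setIT.
have mI : measurable_fun [set: lebesgueT R n] (EFin \o (\1_S : 'rV[R]_n -> R)).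
  by apply/measurable_EFinP; exact: measurable_indic.
rewrite -(ge0_integralZl_EFin leb measurableT _ mI c0); last by move=> z _; rewrite lee_fin.
apply: ge0_le_integral.
- exact: measurableT.
- by move=> z _; rewrite -EFinM lee_fin mulr_ge0.
- rewrite (_ : (fun z => _) = EFin \o (fun z : 'rV[R]_n => c * \1_S z)).
    apply/measurable_EFinP; apply: measurable_funM; first exact: measurable_cst.
    exact: measurable_indic.
  by apply/funext => z; rewrite /= EFinM.
- by have /integrableP[] := iS.
move=> z _; rewrite -EFinM lee_fin indicE.
have [zS|zS] := boolP (z \in S); last by rewrite mulr0 mul0r.
by rewrite mulr1 mul1r; apply: hSK; exact: set_mem.
Qed.

Lemma null_shell (K : 'rV[R]_n -> R) q m : kernel_upper_bounds sigma Lam K ->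
  null_integrable
    (fun z => (sigma == 1)%:R * (\1_(shell (2^-1 ^+ m)) z * dotmul q z) * K z).
Proof.
have [s1 hK|s1 _] := eqVneq sigma 1.
  rewrite s1 in hK; have := shell_cancel n0 hK q m.
  by congr null_integrable; apply/funext => z; rewrite mul1r.
rewrite (_ : (fun z => _) = fun=> 0); first exact: null_integrable0.
by apply/funext => z; rewrite !mul0r.
Qed.

(** Since [rho] is comparable to N d, the near field, the far field and the mass of [S] all scale
    like d^(al - sigma). The near exponent is positive and uses [rho <= 2 * N * d]; the far one is
    negative and uses [N * d <= rho]. *)
Lemma integral_delta_touch (C1 C2 al N C lam mu M : R) (p y : 'rV[R]_n) (r : R)
    (K phi : 'rV[R]_n -> R) (S : set 'rV[R]_n) :
  let d := enorm (y - p) - r in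
  (forall (K : 'rV[R]_n -> R) r, kernel_upper_bounds sigma Lam K -> 0 < r ->
    \int[leb]_z (near_pow sigma r z * K z) <= C1 * r `^ (near_exp sigma - sigma)) ->
  (forall (K : 'rV[R]_n -> R) r, kernel_upper_bounds sigma Lam K -> 0 < r ->
    \int[leb]_z (far_pow sigma r z * K z) <= C2 * r `^ (far_exp sigma - sigma)) ->
  0 <= C1 -> 0 <= C2 -> 0 < al < 1 -> 0 < r -> 0 < d -> 0 < C -> 1 <= N -> C <= N ->
  0 <= lam -> 0 <= mu ->
  2 * N * d < 1 -> al * (2 * N) <= 1 -> al * C <= 4^-1 -> al <= far_exp sigma ->
  C ^+ 2 * d / (2 * r) <= 2^-1 `^ al^-1 ->
  kernel_upper_bounds sigma Lam K ->
  measurable (S : set (lebesgueT R n)) ->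
  S `<=` [set z | dotmul z ((enorm (y - p))^-1 *: (y - p)) < - d]
         `&` (eball 0 (C * d) `\` eball 0 d) ->
  (mu%:E * leb (eball 0 d) <= leb S)%E ->
  (forall z, S z -> (2 - sigma) * lam * d `^ (- n%:R - sigma) <= K z) ->
  Cb2 phi -> 0 <= M ->
  (forall z, phi (y + z) - phi y <= M * (bump al p r (y + z) - bump al p r y)) ->
  \int[leb]_z (delta sigma phi y z * K z) <=
  M * (d `^ (al - sigma) * (al * C1 * (2 * N) `^ (near_exp sigma - sigma)
       + 2 * C2 * N `^ (far_exp sigma - sigma)
       - (2 - sigma) * lam * mu * (2 / n%:R) ^+ n / 4)).
Proof.
move=> d h1 h2 C10 C20 al01 r0 d0 C0 N1 CN lam0 mu0 Nd alN alC als hC hK mS hS leS hSK hphi M0 touch.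
have N0 : 0 < N by exact: lt_le_trans N1.
have al0 : 0 < al by have /andP[] := al01.
have Nd0 : 0 < 2 * N * d < 1 by rewrite !mulr_gt0.
have [m /andP[m1 m2]] := dyadic_between Nd0; rewrite -(mulrA 2 N) in m1.
set rho := 2^-1 ^+ m in m1 m2.
have rho0 : 0 < rho by rewrite exprn_gt0// invr_gt0.
have hrho : N * d <= rho <= 2 * N * d.
  rewrite m2 andbT; apply: le_trans m1.
  by move: (N * d) => e; lra.
have rho1 : rho <= 1 by exact: le_trans m2 (ltW Nd).
pose q := bump_grad al p y r.
pose c1 := al * d `^ (al - near_exp sigma).
pose c2 := 2 * d `^ (al - far_exp sigma).
pose c3 := d `^ al / 4.
have c10 : 0 <= c1 by rewrite mulr_ge0 ?powR_ge0// ltW.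
have c20 : 0 <= c2 by rewrite mulr_ge0 ?powR_ge0.
have c30 : 0 <= c3 by rewrite mulr_ge0 ?powR_ge0// invr_ge0.
pose F1 z := near_pow sigma rho z * K z.
pose F2 z := far_pow sigma rho z * K z.
pose F3 z := \1_S z * K z.
pose F4 (z : 'rV[R]_n) := (sigma == 1)%:R * (\1_(shell rho) z * dotmul q z) * K z.
have i1 : leb.-integrable setT (EFin \o F1) by exact: (integrable_near_pow n0 hs hK).
have i2 : leb.-integrable setT (EFin \o F2) by exact: (integrable_far_pow n0 hs hK).
have Sd : S `<=` ~` eball 0 d by move=> z /hS[_ []].
have [i3 e3] := kernel_mass_ge hK d0 lam0 mu0 mS Sd leS hSK.
have [i4 e4] := null_shell q m hK.
have j4 := integrableZl_EFin (-1) i4.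
have j3 := integrableD_EFin (integrableZl_EFin (- c3) i3) j4.
have j2 := integrableD_EFin (integrableZl_EFin c2 i2) j3.
have j1 := integrableD_EFin (integrableZl_EFin c1 i1) j2.
have jM := integrableZl_EFin M j1.
apply: le_trans.
  apply: (@le_Rintegral _ _ _ leb setT _ _ measurableT _ jM).
    exact: (integrable_delta n0 hs hK).
  move=> z _; have := delta_touch n0 al01 r0 d0 C0 N1 CN hrho rho1 alN alC als hC hS hphi M0 touch z.
  move=> /(ler_wpM2r (kernel_ge0 hK z)) /le_trans; apply.
  rewrite le_eqVlt; apply/orP; left; apply/eqP.
  rewrite /c1 /c2 /c3 /F1 /F2 -/d -/q; ring.
rewrite RintegralZl// ler_wpM2l//.
rewrite RintegralD//; last exact: integrableZl_EFin.
rewrite RintegralD//; last exact: integrableZl_EFin.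
rewrite RintegralD//; last exact: integrableZl_EFin.
rewrite !RintegralZl// e4 mulr0 addr0.
have := h1 K rho hK rho0; rewrite -/F1 => e1.
have := h2 K rho hK rho0; rewrite -/F2 => e2.
have E1 : c1 * \int[leb]_z F1 z <= d `^ (al - sigma) * (al * C1 * (2 * N) `^ (near_exp sigma - sigma)).
  apply: le_trans (ler_wpM2l c10 e1) _; rewrite [leLHS]mulrA.
  have : rho `^ (near_exp sigma - sigma) <= (2 * N * d) `^ (near_exp sigma - sigma).
    apply: ge0_ler_powR; rewrite ?nnegrE ?subr_ge0 ?(ltW (near_exp_gt hs)) ?(ltW rho0)//.
    by rewrite (le_trans (ltW rho0)).
  rewrite powRM ?(ltW d0)// ?mulr_ge0 ?(ltW N0)// => /(ler_wpM2l (mulr_ge0 c10 C10)).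
  move=> /le_trans; apply; rewrite le_eqVlt; apply/orP; left; apply/eqP.
  rewrite /c1 (_ : al - sigma = (al - near_exp sigma) + (near_exp sigma - sigma)); last by ring.
  rewrite [d `^ (_ - _ + _)]powRD; last by apply/implyP => _; rewrite gt_eqF.
  by ring.
have E2 : c2 * \int[leb]_z F2 z <= d `^ (al - sigma) * (2 * C2 * N `^ (far_exp sigma - sigma)).
  apply: le_trans (ler_wpM2l c20 e2) _; rewrite [leLHS]mulrA.
  have : rho `^ (far_exp sigma - sigma) <= (N * d) `^ (far_exp sigma - sigma).
    rewrite -opprB !powRN lef_pV2 ?posrE ?powR_gt0 ?mulr_gt0//.
    have /andP[hr _] := hrho.
    by apply: ge0_ler_powR => //; rewrite ?nnegrE ?(ltW rho0) ?mulr_ge0 ?(ltW d0) ?(ltW N0)// subr_ge0 ltW// (far_exp_lt hs).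
  rewrite powRM ?(ltW d0) ?(ltW N0)// => /(ler_wpM2l (mulr_ge0 c20 C20)).
  move=> /le_trans; apply; rewrite le_eqVlt; apply/orP; left; apply/eqP.
  rewrite /c2 (_ : al - sigma = (al - far_exp sigma) + (far_exp sigma - sigma)); last by ring.
  rewrite [d `^ (_ - _ + _)]powRD; last by apply/implyP => _; rewrite gt_eqF.
  by ring.
have E3 : c3 * ((2 - sigma) * lam * mu * (2 / n%:R) ^+ n * d `^ (- sigma)) =
    d `^ (al - sigma) * ((2 - sigma) * lam * mu * (2 / n%:R) ^+ n / 4).
  rewrite /c3 powRD; first by ring.
  by apply/implyP => _; rewrite gt_eqF.
have := ler_wpM2l c30 e3; rewrite E3 -/F3.
move: E1 E2; set I1 := c1 * _; set I2 := c2 * _.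
rewrite mulrBr mulrDr mulNr; set I3 := \int[leb]_z F3 z.
by set a := d `^ _ * _; set b := d `^ _ * _; set e := d `^ _ * _; clear; lra.
Qed.

End key_estimate.

(** * Choice of the exponent and of the shell *)

Section bump_supersolution.
Context (R : realType) (n : nat) (n0 : (0 < n)%N) (sigma Lam : R).
Hypothesis hs : 0 < sigma < 2.
Local Notation leb := (@lebesgue_rV R n).

(** The constants are fixed before [p], [r], [M] and the kernel, and the shell is measured relative
    to [r]; the barrier can therefore take [r] from the modulus of continuity of [g] and then [M]
    from [r]. *)
Lemma bump_supersolution (C lam mu Bb : R) : 0 < C -> 0 < lam -> 0 < mu -> 0 <= Bb ->
  exists al kap s0 : R, [/\ 0 < al < 1, 0 < kap, 0 < s0 &
  forall (p y b : 'rV[R]_n) (r M : R) (K phi : 'rV[R]_n -> R) (S : set 'rV[R]_n),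
  let d := enorm (y - p) - r in
  0 < r < 1 -> 0 < d -> d < s0 * r ->
  kernel_upper_bounds sigma Lam K ->
  measurable (S : set (lebesgueT R n)) ->
  S `<=` [set z | dotmul z ((enorm (y - p))^-1 *: (y - p)) < - d]
         `&` (eball 0 (C * d) `\` eball 0 d) ->
  (mu%:E * leb (eball 0 d) <= leb S)%E ->
  (forall z, S z -> (2 - sigma) * lam * d `^ (- n%:R - sigma) <= K z) ->
  enorm b <= Bb -> (sigma < 1 -> b = 0) ->
  Cb2 phi -> 0 <= M ->
  (forall z, phi (y + z) - phi y <= M * (bump al p r (y + z) - bump al p r y)) ->
  M * kap <= dotmul b (grad phi y) - \int[leb]_z (delta sigma phi y z * K z)].
Proof.
move=> C0 lam0 mu0 Bb0.
(* [N] makes the far field small against the mass of [S], then [al] the near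
   field and the drift, then [s0] the curvature of the exterior ball. *)
have [C1 C10 hC1] := near_moment n0 Lam (near_exp_gt0 sigma) (near_exp_gt hs).
have [C2 C20 hC2] := far_moment n0 Lam (far_exp_gt0 hs) (far_exp_lt hs).
pose k0 := (2 - sigma) * lam * mu * (2 / n%:R) ^+ n.
have k00 : 0 < k0.
  rewrite /k0 !mulr_gt0 ?exprn_gt0 ?divr_gt0 ?ltr0n// subr_gt0.
  by have /andP[] := hs.
pose a := sigma - far_exp sigma.
have a0 : 0 < a by rewrite subr_gt0 far_exp_lt.
pose X := 32 * (C2 + 1) / k0.
have X0 : 0 < X by rewrite divr_gt0// mulr_gt0// ltr_wpDl.
pose N := Num.max (Num.max 1 C) (X `^ a^-1).
have N1 : 1 <= N by rewrite !le_max lexx.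
have CN : C <= N by rewrite !le_max lexx orbT.
have N0 : 0 < N by exact: lt_le_trans N1.
have hN : 2 * C2 * N `^ (far_exp sigma - sigma) <= k0 / 16.
  have XN : X <= N `^ a.
    rewrite -[leLHS](powRr1 (ltW X0)) -(mulVf (lt0r_neq0 a0)) powRrM.
    by apply: ge0_ler_powR; rewrite ?nnegrE ?powR_ge0 ?(ltW a0) ?(ltW N0)// le_max lexx orbT.
  rewrite -opprB powRN -/a ler_pdivrMr ?powR_gt0//.
  apply: le_trans (ler_wpM2l _ XN); last by rewrite divr_ge0// ltW.
  rewrite /X (_ : k0 / 16 * _ = 2 * (C2 + 1)); last by field; rewrite gt_eqF.
  by rewrite ler_wpM2l// lerDl.
clearbody N.
pose P := (2 * N) `^ (near_exp sigma - sigma).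
have P0 : 0 < P by rewrite powR_gt0// mulr_gt0.
pose al := Num.min (Num.min (Num.min 2^-1 (2 * N)^-1) (Num.min (4^-1 / C) (far_exp sigma)))
  (Num.min (k0 / 16 / ((C1 + 1) * P)) (k0 / 16 / (Bb + 1))).
have C1p : 0 < C1 + 1 by rewrite ltr_wpDl.
have Bbp : 0 < Bb + 1 by rewrite ltr_wpDl.
have al0 : 0 < al.
  rewrite !lt_min; apply/andP; split; apply/andP; split.
  - by apply/andP; split; rewrite invr_gt0// mulr_gt0.
  - by apply/andP; split; [rewrite divr_gt0// invr_gt0|exact: far_exp_gt0].
  - by apply: divr_gt0; [exact: divr_gt0|exact: mulr_gt0].
  - by apply: divr_gt0 => //; exact: divr_gt0.
have : al <= al by [].
rewrite {2}/al !le_min => /andP[/andP[/andP[al2 alN] /andP[alC als]] /andP[alC1 alB]].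
have al01 : 0 < al < 1.
  by rewrite al0/=; apply: le_lt_trans al2 _; rewrite invf_lt1// ltr1n.
have {}alN : al * (2 * N) <= 1 by rewrite -ler_pdivlMr ?mulr_gt0// div1r.
have {}alC : al * C <= 4^-1 by rewrite -ler_pdivlMr.
have {}alC1 : al * C1 * P <= k0 / 16.
  apply: (@le_trans _ _ (al * ((C1 + 1) * P))).
    by rewrite mulrA ler_wpM2r ?(ltW P0)// ler_wpM2l ?(ltW al0)// lerDl.
  by rewrite -ler_pdivlMr// mulr_gt0.
have {}alB : al * Bb <= k0 / 16.
  apply: (@le_trans _ _ (al * (Bb + 1))); first by rewrite ler_wpM2l ?(ltW al0)// lerDl.
  by rewrite -ler_pdivlMr.
pose H := 2^-1 `^ al^-1 : R.
have H0 : 0 < H by rewrite powR_gt0// invr_gt0.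
(* As [r < 1], the first entry gives 2 N d < 1, so that the near field stays in the unit ball; the
   second is the curvature condition of [bump_cone]. *)
pose s0 := Num.min (2 * N)^-1 (2 * H / C ^+ 2).
have s00 : 0 < s0 by rewrite lt_min invr_gt0 ?divr_gt0 ?mulr_gt0 ?exprn_gt0.
(* Of the gain k0 / 4 coming from [S], the near field, the far field and the drift each consume at
   most k0 / 16. The common factor d^(al - sigma) is at least 1 because d <= 1 and [al < sigma]. *)
exists al, (k0 / 16), s0; split => //; first by rewrite divr_gt0.
move=> p y b r M K phi S d /andP[r0 r1] d0 ds hK mS hS leS hSK hb hb0 hphi M0 touch.
have ds0 : d < s0 by apply: lt_le_trans ds _; rewrite ler_piMr ?(ltW s00)// ltW.
have Nd : 2 * N * d < 1.
  rewrite mulrC -ltr_pdivlMr ?mulr_gt0// div1r; apply: lt_le_trans ds0 _.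
  by rewrite ge_min lexx.
have d1 : d <= 1.
  by apply: le_trans (ltW Nd); rewrite ler_peMl ?(ltW d0)//; move: N1; lra.
have hC : C ^+ 2 * d / (2 * r) <= 2^-1 `^ al^-1.
  rewrite ler_pdivrMr ?mulr_gt0// -/H.
  have : s0 <= 2 * H / C ^+ 2 by rewrite ge_min lexx orbT.
  rewrite ler_pdivlMr ?exprn_gt0// => h.
  have := ler_wpM2r (ltW r0) h; have := ler_wpM2l (sqr_ge0 C) (ltW ds).
  by set c2 := C ^+ 2; lra.
have hg : grad phi y = M *: bump_grad al p y r.
  exact: (grad_touch n0 al01 r0 d0 hphi M0 touch).
have := @integral_delta_touch R n n0 sigma Lam hs C1 C2 al N C lam mu M p y r K phi S.
move=> /(_ (fun K r h1 h2 => (hC1 K r h1 h2).2) (fun K r h1 h2 => (hC2 K r h1 h2).2)).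
move=> /(_ C10 C20 al01 r0 d0 C0 N1 CN (ltW lam0) (ltW mu0) Nd alN alC als hC hK mS hS leS hSK hphi M0 touch).
rewrite -/k0 -/P -/d => hI.
pose D := d `^ (al - sigma).
have D1 : 1 <= D.
  rewrite /D -opprB powRN invf_ge1 ?powR_gt0// -(powRr0 d).
  apply: ger_powR; first by rewrite d0.
  by rewrite subr_ge0; apply: le_trans als _; exact: ltW (far_exp_lt hs).
have hI2 : \int[leb]_z (delta sigma phi y z * K z) <= M * (D * (- (k0 / 8))).
  apply: le_trans hI _; rewrite ler_wpM2l// ler_wpM2l ?(le_trans ler01 D1)//.
  by move: alC1 hN; lra.
have hd : - (M * (D * (k0 / 16))) <= dotmul b (grad phi y).
  (* For [sigma >= 1] and d <= 1 the gradient, of size d^(al - 1), is dominated by d^(al - sigma);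
     for [sigma < 1] the drift vanishes. *)
  have [s1|s1] := ltP sigma 1.
    rewrite hb0// dotmulC dotmul0r oppr_le0 mulr_ge0//.
    by rewrite mulr_ge0 ?(le_trans ler01 D1)// divr_ge0// ltW.
  rewrite hg dotmulZr -mulrN ler_wpM2l//.
  have := cauchy_schwarz b (bump_grad al p y r); rewrite ler_norml => /andP[+ _].
  apply: le_trans; rewrite lerN2 enorm_bump_grad//.
  apply: (@le_trans _ _ (Bb * (al * d `^ (al - 1)))).
    by rewrite ler_wpM2r// mulr_ge0 ?powR_ge0 ?(ltW al0).
  rewrite mulrA (mulrC Bb) [leLHS]mulrC; apply: ler_pM; rewrite ?powR_ge0 ?mulr_ge0 ?(ltW al0)//.
  by rewrite /D; apply: ger_powR; [rewrite d0|rewrite lerB].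
have hM : M * (k0 / 16) <= M * (D * (k0 / 16)).
  by rewrite ler_wpM2l// ler_peMl// ltW// divr_gt0.
have e : M * (D * (- (k0 / 8))) = - (2 * (M * (D * (k0 / 16)))) by field.
move: hI2 hd hM; rewrite e; set T := M * (D * _); set I := \int[leb]_z _.
by set G := dotmul _ _; set U := M * _; lra.
Qed.

End bump_supersolution.

(** * Infima of barriers *)

Section perron.
Context (R : realType) (n : nat) (n0 : (0 < n)%N).
Implicit Types (w u g phi : 'rV[R]_n -> R) (x y z : 'rV[R]_n).

Lemma compact_boundary (A : set 'rV[R]_n) : bounded_set A -> compact (boundary A).
Proof.
move=> [M [Mr hM]]; apply: bounded_closed_compact; last first.
  rewrite /boundary setDE; apply: closedI; first exact: closed_closure.
  by rewrite closedC; exact: open_interior.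
exists (`|M| + 1 + 1); split; first exact: num_real.
move=> B hB x [/(_ _ (nbhsx_ballx x 1 ltr01)) [y [Ay xy]] _].
apply: le_trans (ltW hB); rewrite -(subrK y x).
apply: le_trans (ler_normD _ _) _; rewrite addrC lerD//.
  by apply: (hM (`|M| + 1)) => //; rewrite (le_lt_trans (ler_norm _))// ltrDl.
by move: xy; rewrite -ball_normE /ball_/= => /ltW.
Qed.

Variables (Omega : set 'rV[R]_n) (g : 'rV[R]_n -> R) (k : R).
Variable T : 'rV[R]_n -> R -> ('rV[R]_n -> R) -> Prop.
Hypotheses (oOmega : open Omega) (bOmega : bounded_set Omega).
Hypotheses (cg : continuous g) (gk : forall x, g x <= k).

(** The test property is required only where [w < k]; elsewhere the constant [k] takes over in the
    minimum. The predicate [T] stands for the inequality satisfied by test functions, so the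
    construction does not depend on the operator. *)
Record upper_barrier w : Prop := UpperBarrier {
  upper_barrier_continuous : continuous w;
  upper_barrier_ge : forall x, g x <= w x;
  upper_barrier_touch : forall x phi, Omega x -> w x < k -> Cb2 phi ->
    (forall z, w x - phi x <= w z - phi z) -> T x (w x) phi }.

Lemma upper_barrier_cst : upper_barrier (fun=> k).
Proof.
by split => // [x|x phi _]; [exact: cst_continuous|rewrite ltxx].
Qed.

Lemma upper_barrier_min w1 w2 : upper_barrier w1 -> upper_barrier w2 ->
  upper_barrier (fun x => Num.min (w1 x) (w2 x)).
Proof.
move=> [c1 g1 t1] [c2 g2 t2]; split.
- by move=> x; exact: continuous_min (c1 x) (c2 x).
- by move=> x; rewrite le_min g1 g2.
move=> x phi Ox; have [w12|w21] := leP (w1 x) (w2 x) => wk hphi touch.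
  apply: t1 => // z; apply: le_trans (touch z) _.
  by rewrite lerD2r ge_min lexx.
apply: t2 => // z; apply: le_trans (touch z) _.
by rewrite lerD2r ge_min lexx orbT.
Qed.

Hypothesis barrier : forall e x, 0 < e -> boundary Omega x -> exists w,
  [/\ upper_barrier w, w x < g x + e &
      forall y, eball y e `<=` Omega -> k <= w y].

(** Each inequality w < g + e persists near its boundary point, and compactness leaves finitely many
    of them. The minimum starts from the constant [k], so the result equals [k] at depth e; this
    will make the infimum over e locally finite. *)
Lemma uniform_barrier e : 0 < e -> exists w,
  [/\ upper_barrier w, forall x, boundary Omega x -> w x < g x + e,
      forall y, w y <= k & forall y, eball y e `<=` Omega -> w y = k].
Proof.
move=> e0.
have /choice[W hW] : forall x, exists w, boundary Omega x ->
    [/\ upper_barrier w, w x < g x + e & forall y, eball y e `<=` Omega -> k <= w y].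
  move=> x; have [bx|bx] := pselect (boundary Omega x); last by exists g.
  by have [w hw] := barrier e0 bx; exists w.
pose f x := [set y | W x y < g y + e]°.
have cW x y : boundary Omega x -> W x y < g y + e -> f x y.
  move=> bx hxy; rewrite /f /interior/=; apply/(nbhs_enormP _ _ n0).
  have [[cw _ _] _ _] := hW x bx.
  pose t := (g y + e - W x y) / 2.
  have t0 : 0 < t by rewrite divr_gt0// subr_gt0.
  have [d1 d10 h1] := (continuous_enormP (W x) y n0).1 (cw y) t t0.
  have [d2 d20 h2] := (continuous_enormP g y n0).1 (@cg y) t t0.
  exists (Num.min d1 d2); first by rewrite lt_min d10.
  move=> z; rewrite /eball/= lt_min => /andP[/h1 + /h2].
  rewrite !ltr_norml => /andP[_ a1] /andP[a2 _].
  by move: a1 a2; rewrite /t; lra.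
have := compact_boundary bOmega; rewrite compact_cover.
case/(_ _ (boundary Omega) f).
- by move=> x _; exact: open_interior.
- by move=> x bx; exists x => //; apply: cW => //; have [] := hW x bx.
move=> D sD cD.
have sub (s : seq 'rV[R]_n) : (forall x, x \in s -> boundary Omega x) ->
    exists w, [/\ upper_barrier w, forall x y, x \in s -> w y <= W x y,
      forall y, w y <= k & forall y, eball y e `<=` Omega -> w y = k].
  elim: s => [_|x s ih hs]; first by exists (fun=> k); split=> //; exact: upper_barrier_cst.
  have [y ys|w [bw ws wk we]] := ih; first by apply: hs; rewrite in_cons ys orbT.
  have [bx _ ex] := hW x (hs x (mem_head _ _)).
  exists (fun y => Num.min (W x y) (w y)); split.
  - exact: upper_barrier_min.
  - move=> x' y; rewrite in_cons => /predU1P[->|xs]; first by rewrite ge_min lexx.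
    by rewrite ge_min (ws _ _ xs) orbT.
  - by move=> y; rewrite ge_min wk orbT.
  - by move=> y ey; rewrite (we y ey); apply/min_idPr; exact: ex.
have [x xD|w [bw ws wk we]] := sub (finmap.enum_fset D).
  by have := sD x xD; rewrite inE.
exists w; split => // x bx; have [i /= iD fi] := cD x bx.
apply: le_lt_trans (ws i x iD) _.
by have := interior_subset fi.
Qed.

Lemma perron_min : exists u, [/\ continuous u, forall x, ~ Omega x -> u x = g x,
  forall x, g x <= u x <= k &
  forall x phi, Cb2 phi -> Omega x -> (forall y, u x - phi x <= u y - phi y) ->
    (u x < k -> T x (u x) phi)].
Proof.
have e0 j : 0 < j.+1%:R^-1 :> R by rewrite invr_gt0.
have [V hV] := choice (fun j => uniform_barrier (e0 j)).
(* [U J] is the minimum of [k] and of [V 0], ..., [V (J - 1)], where [V j] has the error 1/(j +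
   1). *)
pose U J x := iteri J (fun j v => Num.min v (V j x)) k.
have US J x : U J.+1 x = Num.min (U J x) (V J x) by [].
have bU J : upper_barrier (U J).
  elim: J => [|J ih].
    exact: upper_barrier_cst.
  rewrite (_ : U J.+1 = fun x => Num.min (U J x) (V J x)); last exact/funext/US.
  by apply: upper_barrier_min => //; have [] := hV J.
have Uk J x : U J x <= k.
  elim: J => [|J ih]; first exact: lexx.
  by rewrite US ge_min ih.
have Umono J J' x : (J <= J')%N -> U J' x <= U J x.
  move/subnK => <-; elim: (J' - J)%N => [|m ih]; first by rewrite add0n.
  by rewrite addSn US ge_min ih.
have UV J x : U J.+1 x <= V J x by rewrite US ge_min lexx orbT.
(* At depth [d] the barriers of index at least [J] equal [k], so they no longer lower the
   minimum. *)
have stab y d J : 0 < d -> J.+1%:R^-1 <= d -> eball y d `<=` Omega ->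
    forall J', (J <= J')%N -> U J' y = U J y.
  move=> d0 Jd hy J' /subnK <-; elim: (J' - J)%N => [|m ih]; first by rewrite add0n.
  rewrite addSn US ih; have [_ _ _ ->] := hV (m + J)%N; first by rewrite min_l.
  move=> z zy; apply: hy; rewrite /eball/=; apply: lt_le_trans zy _; apply: le_trans Jd.
  by rewrite lef_pV2 ?posrE// ler_nat ltnS leq_addl.
have largeJ d : 0 < d -> exists J : nat, J.+1%:R^-1 <= d :> R.
  move=> d0; exists (Num.truncn d^-1).
  by rewrite -[leRHS]invrK lef_pV2 ?posrE ?invr_gt0// ltW// truncnS_gt.
have inner x : Omega x -> exists2 d, 0 < d & forall y, enorm (y - x) < d -> eball y d `<=` Omega.
  move=> Ox; have /(nbhs_enormP _ _ n0)[d d0 hd] : nbhs x Omega by exact: open_nbhs_nbhs.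
  exists (d / 2); first by rewrite divr_gt0.
  move=> y yx z zy; apply: hd; rewrite /eball/= -(subrK y z) -addrA.
  apply: le_lt_trans (enormD _ _) _; move: zy yx; rewrite /eball/=; lra.
(* Outside [Omega] the value is set to [g], which the barriers need not approach there; continuity
   at the boundary is then a separate matter. *)
have /choice[u hu] : forall y, exists v, (Omega y -> exists J, forall J', (J <= J')%N -> U J' y = v) /\
    (~ Omega y -> v = g y).
  move=> y; have [Oy|nOy] := pselect (Omega y); last by exists (g y).
  have [d d0 hd] := inner y Oy; have [J hJ] := largeJ d d0.
  exists (U J y); split => // _; exists J; apply: (stab y d) => //; apply: hd.
  by rewrite subrr enorm0.
have uU x J : Omega x -> u x <= U J x.
  move=> Ox; have [/(_ Ox)[J1 h1] _] := hu x; rewrite -(h1 (maxn J J1)) ?leq_maxr//.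
  by apply: Umono; rewrite leq_maxl.
have uE y d J : 0 < d -> J.+1%:R^-1 <= d -> eball y d `<=` Omega -> u y = U J y.
  move=> d0 Jd hy.
  have Oy : Omega y by apply: hy; rewrite /eball/= subrr enorm0.
  have [/(_ Oy)[J1 h1] _] := hu y; rewrite -(h1 (maxn J J1)) ?leq_maxr//.
  by apply: (stab y d) => //; rewrite leq_maxl.
have gu x : g x <= u x <= k.
  have [h1 h2] := hu x; have [Ox|nOx] := pselect (Omega x); last by rewrite h2// lexx gk.
  by have [J hJ] := h1 Ox; rewrite -(hJ J)// (upper_barrier_ge (bU J)) Uk.
(* The comparison must hold outside [Omega] as well: touching is a global condition, and it has to
   pass from [u] to [U J]. *)
have uUg x J : u x <= U J x.
  have [Ox|nOx] := pselect (Omega x); first exact: uU.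
  by rewrite (hu x).2// (upper_barrier_ge (bU J)).
exists u; split => //.
- move=> x; have [Ox|nOx] := pselect (Omega x).
    have [d d0 hd] := inner x Ox; have [J hJ] := largeJ d d0.
    have cU := upper_barrier_continuous (bU J).
    apply/(continuous_enormP _ _ n0) => e e00.
    have [d' d'0 h] := (continuous_enormP (U J) x n0).1 (cU x) e e00.
    exists (Num.min d d'); first by rewrite lt_min d0.
    move=> y; rewrite lt_min => /andP[yd yd'].
    by rewrite (uE y d J)// ?(uE x d J)//; [exact: h|apply: hd; rewrite subrr enorm0|exact: hd].
  have ux : u x = g x by exact: (hu x).2.
  apply/(continuous_enormP _ _ n0) => e e00.
  have [d1 d10 h1] := (continuous_enormP g x n0).1 (@cg x) e e00.
  have [bx|nbx] := pselect (boundary Omega x); last first.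
    have /(nbhs_enormP _ _ n0)[d d0 hd] : nbhs x (~` Omega).
      apply: contrapT => h; apply: nbx; split; last by move/interior_subset.
      move=> B xB; apply: contrapT => hB; apply: h; apply: filterS xB => z Bz Oz.
      by apply: hB; exists z.
    exists (Num.min d d1); first by rewrite lt_min d0.
    move=> y; rewrite lt_min => /andP[/hd nOy /h1].
    by rewrite ux (hu y).2.
  (* One half of [e] pays for the excess of [V J x] over [g x], the other for the oscillation of
     [V J] near [x]; the lower bound is [g <= u]. *)
  have e20 : 0 < e / 2 by rewrite divr_gt0.
  have [J hJ] := largeJ _ e20.
  have [bV Vx _ _] := hV J.
  have [d2 d20 h2] := (continuous_enormP (V J) x n0).1 (@upper_barrier_continuous _ bV x) _ e20.
  exists (Num.min d1 d2); first by rewrite lt_min d10.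
  move=> y; rewrite lt_min => /andP[/h1 + /h2]; rewrite ux !ltr_norml => /andP[a1 a2] /andP[_ b2].
  have /andP[gy _] := gu y; have := Vx x bx; have := le_trans (uUg y J.+1) (UV J y).
  move=> c1 c2; apply/andP; split; first exact: lt_le_trans a1 (lerB gy (lexx _)).
  have step (a b c t : R) : a - b < e / 2 -> b < c + t -> t <= e / 2 -> a - c < e by lra.
  exact: le_lt_trans (lerB c1 (lexx _)) (step _ _ _ _ b2 c2 hJ).
- by move=> x nOx; exact: (hu x).2.
move=> x phi hphi Ox touch uk.
have [d d0 hd] := inner x Ox; have [J hJ] := largeJ d d0.
have xE : u x = U J x by apply: (uE x d J) => //; apply: hd; rewrite subrr enorm0.
rewrite xE; apply: (upper_barrier_touch (bU J)) => //; first by rewrite -xE.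
by move=> z; rewrite -xE; apply: le_trans (touch z) _; rewrite lerD2r.
Qed.

End perron.

(** * Existence *)

Lemma ler_sub_touch (R : realDomainType) (s a b u v : R) :
  s + a - u <= s + b - v -> v - u <= b - a.
Proof. lra. Qed.

Section supersolution.
Context (R : realType) (n : nat) (n0 : (0 < n)%N) (A B : Type).
Context (Omega : set 'rV[R]_n) (hOmega : bounded_domain Omega).
Context (rO : R) (yb : 'rV[R]_n -> R -> 'rV[R]_n).
Hypothesis hball : uniform_exterior_ball Omega rO yb.
Context (sigma : R) (hs : 0 < sigma < 2).
Context (K : A -> B -> 'rV[R]_n -> 'rV[R]_n -> R).
Context (bb : A -> B -> 'rV[R]_n -> 'rV[R]_n) (c f : A -> B -> 'rV[R]_n -> R).
Hypothesis hbb0 : sigma < 1 -> forall a b x, Omega x -> bb a b x = 0.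
Context (gamma : R) (hgamma : 0 < gamma).
Hypothesis hcgamma : forall a b x, Omega x -> gamma <= c a b x.
Context (g : 'rV[R]_n -> R) (hgb : [bounded g x | x in [set: 'rV[R]_n]]).
Hypothesis hgc : continuous g.
Hypothesis hbbb : equi_bounded (@enorm R n) Omega (fun i : A * B => bb i.1 i.2).
Hypothesis hcb : equi_bounded Num.norm Omega (fun i : A * B => c i.1 i.2).
Hypothesis hfb : equi_bounded Num.norm Omega (fun i : A * B => f i.1 i.2).
Context (Lam : R).
Hypothesis hKup : forall a b x, Omega x -> kernel_upper_bounds sigma Lam (K a b x).
Hypothesis hKnd : boundary_nondegenerate sigma K Omega rO yb.

Definition classical_ge0 (x : 'rV[R]_n) (v : R) (phi : 'rV[R]_n -> R) : Prop :=
  forall a b, 0 <= - nonlocal_op sigma (K a b) x phi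
    + dotmul (bb a b x) (grad phi x) + c a b x * v + f a b x.

Lemma boundary_open_notin (x : 'rV[R]_n) : boundary Omega x -> ~ Omega x.
Proof.
have [oO _ _ _] := hOmega.
by move=> [_ nx] Ox; apply: nx; exact: open_nbhs_nbhs.
Qed.

Lemma nonlocal_op_le0 a b x phi : Omega x -> Cb2 phi ->
  (forall y, phi y <= phi x) -> nonlocal_op sigma (K a b) x phi <= 0 /\ grad phi x = 0.
Proof.
move=> Ox hphi hmax; have hK := hKup a b Ox.
have hg : grad phi x = 0.
  apply: (@grad_eq_of_le _ _ phi x 0 0 1) => // z _.
  by rewrite dotmulC dotmul0r mul0r addr0 subr_le0.
split => //; rewrite /nonlocal_op.
have -> : 0 = \int[@lebesgue_rV R n]_z (0 : R) by rewrite /Rintegral integral0.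
apply: le_Rintegral => //.
- exact: (integrable_delta n0 hs hK).
- exact: integrable0.
move=> z _; rewrite deltaE hg dotmulC dotmul0r mulr0 subr0.
by rewrite mulr_le0_ge0 ?subr_le0// (kernel_ge0 hK).
Qed.

(** For the points where the solution attains its upper bound [k], about which the barriers say
    nothing: a function touching from below has a global maximum there. *)
Lemma supersolution_max k : (forall a b x, Omega x -> 0 <= c a b x * k + f a b x) ->
  forall x phi, Omega x -> Cb2 phi -> (forall y, phi y <= phi x) ->
  classical_ge0 x k phi.
Proof.
move=> hk x phi Ox hphi hmax a b.
have [hI ->] := nonlocal_op_le0 a b Ox hphi hmax.
by rewrite dotmul0r addr0 -addrA addr_ge0 ?oppr_ge0// hk.
Qed.

Lemma exists_barrier (G k : R) : (forall x, `|g x| <= G) -> G <= k ->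
  forall e x, 0 < e -> boundary Omega x -> exists w,
  [/\ upper_barrier Omega g k classical_ge0 w, w x < g x + e &
      forall y, eball y e `<=` Omega -> k <= w y].
Proof.
move=> hG Gk e x0 e0 bx0.
have [C4 [r1 [lam [mu [C40 /andP[r10 r1O] lam0 mu0 hnd]]]]] := hKnd.
have [/andP[rO0 rO1] hb] := hball.
have [Bb0 hBb0] := hbbb; have [Cc0 hCc0] := hcb; have [Ff0 hFf0] := hfb.
pose Bb := `|Bb0|; pose Cc := `|Cc0|; pose Ff := `|Ff0|.
have hBb a b x : Omega x -> enorm (bb a b x) <= Bb.
  by move=> Ox; apply: le_trans (hBb0 (a, b) x Ox) (ler_norm _).
have hCc a b x : Omega x -> `|c a b x| <= Cc.
  by move=> Ox; apply: le_trans (hCc0 (a, b) x Ox) (ler_norm _).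
have hFf a b x : Omega x -> `|f a b x| <= Ff.
  by move=> Ox; apply: le_trans (hFf0 (a, b) x Ox) (ler_norm _).
have [al [kap [s0 [al01 kap0 s00 key]]]] :=
  bump_supersolution n0 Lam hs C40 lam0 mu0 (normr_ge0 Bb0).
have al0 : 0 < al by have /andP[] := al01.
have G0 : 0 <= G by exact: le_trans (hG x0).
have k0 : 0 <= k by exact: le_trans Gk.
have e20 : 0 < e / 2 by rewrite divr_gt0.
have [del del0 hdel] := (continuous_enormP g x0 n0).1 (@hgc x0) _ e20.
(* The shell lies within 3 r of [x0], hence where [g] is within e / 2 of [g x0]. A point at depth e
   is at distance at least e - 2 r >= 2 r from the exterior ball, hence beyond the shell. *)
pose r := Num.min (r1 / 2) (Num.min (del / 3) (e / 4)).
have r0 : 0 < r by rewrite !lt_min; apply/and3P; split; exact: divr_gt0.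
have : r <= r by [].
rewrite {2}/r !le_min => /andP[rr1 /andP[rdel re]].
clearbody r.
have rlt : r < r1 by apply: le_lt_trans rr1 _; lra.
have r01 : 0 < r < 1 by rewrite r0 (lt_trans rlt)// (lt_trans r1O).
have rO' : 0 < r <= rO by rewrite r0 ltW// (lt_trans rlt).
have [_ hx0] := hb x0 r bx0 rO'.
set p := yb x0 r in hx0.
have x0p : enorm (x0 - p) <= r.
  have : (eclosed_ball p r `&` closure Omega) x0 by rewrite hx0.
  by case.
have nOx0 := boundary_open_notin bx0.
have outp y : Omega y -> 0 < enorm (y - p) - r.
  move=> Oy; rewrite subr_gt0 ltNge; apply/negP => h; apply: nOx0.
  have : (eclosed_ball p r `&` closure Omega) y by split => //; exact: subset_closure.
  by rewrite hx0 => <-.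
(* The thickness of the shell: at most [s0 * r] for the estimate, at most [r] to stay in the ball of
   radius 2 r where nondegeneracy is assumed. *)
pose t0 := Num.min s0 1 * r.
have t00 : 0 < t0 by rewrite mulr_gt0// lt_min s00 ltr01.
have t0r : t0 <= r by rewrite ler_piMl ?(ltW r0)// ge_min lexx orbT.
have t0s : t0 <= s0 * r by rewrite ler_wpM2r ?(ltW r0)// ge_min lexx.
pose H := t0 `^ al; have H0 : 0 < H by exact: powR_gt0.
have bumpH y : t0 <= enorm (y - p) - r -> H <= bump al p r y.
  move=> h; have h0 : 0 <= enorm (y - p) - r by exact: le_trans (ltW t00) h.
  rewrite bump_out//; apply: ge0_ler_powR => //; first exact: ltW.
  by rewrite nnegrE ltW.
(* The first summand lifts [w] above [k] beyond the shell, where the bump is at least [H], even if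
   [g x0 = - G]; the second lets [M * kap] absorb the zero-order and source terms. *)
pose M := (k + 2 * G) / H + (Cc * k + Ff) / kap.
have kG0 : 0 <= k + 2 * G by rewrite addr_ge0// mulr_ge0.
have CF0 : 0 <= Cc * k + Ff by rewrite addr_ge0 ?mulr_ge0 ?normr_ge0.
have M0 : 0 <= M by rewrite addr_ge0// divr_ge0// ltW.
have Mkap : Cc * k + Ff <= M * kap.
  rewrite /M [leRHS]mulrDl [X in _ <= _ + X]divfK ?gt_eqF// lerDr.
  by rewrite mulr_ge0 ?divr_ge0// ltW.
have MH y : t0 <= enorm (y - p) - r -> k + 2 * G <= M * bump al p r y.
  move=> /bumpH h; apply: le_trans (ler_wpM2l M0 h).
  rewrite /M [leRHS]mulrDl divfK ?gt_eqF// lerDl.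
  by rewrite mulr_ge0 ?divr_ge0// ltW.
have gx0 := hG x0; rewrite ler_norml in gx0; have /andP[gx01 gx02] := gx0.
pose w z := g x0 + e / 2 + M * bump al p r z.
have wk y : t0 <= enorm (y - p) - r -> k <= w y.
  by move=> /MH; rewrite /w; move: gx01 e20 G0; set m := M * _; lra.
have wg y : g y <= w y.
  have [h|h] := leP t0 (enorm (y - p) - r).
    apply: le_trans (wk y h); apply: le_trans Gk.
    by apply: le_trans (hG y); exact: ler_norm.
  have : `|g y - g x0| < e / 2.
    apply: hdel; have := enormD (y - p) (p - x0); rewrite addrA subrK (enormB p).
    by move: x0p h t0r rdel r0; lra.
  rewrite ltr_norml /w => /andP[_]; have : 0 <= M * bump al p r y.
    by rewrite mulr_ge0// bump_ge0.
  by set m := M * _; lra.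
exists w; split; last first.
- move=> y hy; apply: wk; apply: le_trans t0r _.
  have : e <= enorm (x0 - y).
    by rewrite leNgt; apply/negP => h; apply: nOx0; exact: hy.
  have := enormD (x0 - p) (p - y); rewrite addrA subrK (enormB p).
  by move: x0p re r0; lra.
- rewrite /w /bump max_r ?subr_le0// powR0 ?gt_eqF// mulr0 addr0.
  by rewrite ltrD2l; move: e0; lra.
split => //.
  move=> z; apply/(continuous_enormP _ _ n0) => t tpos.
  have M1 : 0 < M + 1 by rewrite ltr_wpDl.
  have [d d0 hd] := (continuous_enormP (bump al p r) z n0).1
    (@bump_continuous R n n0 al p r al01 z) _ (divr_gt0 tpos M1).
  exists d => // z' /hd; rewrite ltr_pdivlMr//; apply: le_lt_trans.
  rewrite /w opprD addrACA subrr add0r -mulrBr.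
  by rewrite normrM ger0_norm// mulrC ler_wpM2l// lerDl.
move=> y phi Oy wyk hphi touch a b.
have d0 := outp y Oy.
have dt0 : enorm (y - p) - r < t0.
  by rewrite ltNge; apply/negP => /wk; rewrite leNgt wyk.
have y2r : eball p (2 * r) y by rewrite /eball/=; move: dt0 t0r; lra.
have rlt' : 0 < r < r1 by rewrite r0.
have [S] := hnd x0 r y a b bx0 rlt' Oy y2r.
have -> : r * (enorm (y - yb x0 r) / r - 1) = enorm (y - p) - r.
  by rewrite -/p; field; rewrite gt_eqF.
rewrite -/p => -[mS hS leS hSK].
have touch' z : phi (y + z) - phi y <= M * (bump al p r (y + z) - bump al p r y).
  by rewrite mulrBr; exact: ler_sub_touch (touch (y + z)).
have ds : enorm (y - p) - r < s0 * r by exact: lt_le_trans dt0 t0s.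
have hb0 : sigma < 1 -> bb a b y = 0 by move=> s1; exact: hbb0.
have := key p y (bb a b y) r M (K a b y) phi S r01 d0 ds (hKup a b Oy) mS hS leS hSK
  (hBb a b y Oy) hb0 hphi M0 touch'.
rewrite -/(nonlocal_op sigma (K a b) y phi); set I := nonlocal_op _ _ _ _.
set D := dotmul _ _ => hkey.
(* Here |w y| <= k, since w y < k at the points tested and w y >= g y >= - G >= - k. *)
have hc : - (Cc * k) <= c a b y * w y.
  rewrite lerNl -mulrN; apply: le_trans (ler_norm _) _.
  rewrite normrM normrN ler_pM// ?hCc//.
  rewrite ler_norml (ltW wyk) andbT.
  apply: le_trans (wg y); have := hG y; rewrite ler_norml => /andP[+ _].
  by move: Gk; lra.
have := hFf a b y Oy; rewrite ler_norml => /andP[hf _].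
by move: Mkap hkey hc hf; set x1 := c a b y * _; set x2 := M * kap; set x3 := Cc * k; lra.
Qed.

Lemma exists_supersolution : exists u, [/\ continuous u,
  [bounded u x | x in [set: 'rV[R]_n]], forall x, ~ Omega x -> u x = g x &
  forall phi x, Cb2 phi -> Omega x -> (forall y, u x - phi x <= u y - phi y) ->
    classical_ge0 x (u x) phi].
Proof.
have [oO _ _ bO] := hOmega.
have [G0 [G0r hG0]] := hgb.
pose G := `|G0| + 1.
have hG x : `|g x| <= G.
  by apply: (hG0 G) => //; rewrite (le_lt_trans (ler_norm _))// ltrDl.
have [Ff0 hFf0] := hfb; pose Ff := `|Ff0|.
have hFf a b x : Omega x -> `|f a b x| <= Ff.
  by move=> Ox; apply: le_trans (hFf0 (a, b) x Ox) (ler_norm _).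
(* This gives gamma k >= Ff, hence c k + f >= 0, besides k >= g. *)
pose k := G + Ff / gamma.
have Ff_ge0 : 0 <= Ff by exact: normr_ge0.
have Gk : G <= k by rewrite lerDl divr_ge0// ltW.
have k0 : 0 <= k by rewrite (le_trans _ Gk)// addr_ge0.
have gk x : g x <= k by rewrite (le_trans (ler_norm _))// (le_trans (hG x)).
have hk a b x : Omega x -> 0 <= c a b x * k + f a b x.
  move=> Ox; have := hFf a b x Ox; rewrite ler_norml => /andP[hf _].
  have h1 : Ff <= gamma * k.
    by rewrite mulrDr mulrCA divff ?gt_eqF// mulr1 lerDr mulr_ge0 ?(ltW hgamma)// addr_ge0// normr_ge0.
  have := ler_wpM2r k0 (hcgamma a b Ox).
  by set X := c a b x * k; move: h1; set Y := gamma * k; lra.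
have [u [cu uO gu hu]] := perron_min n0 oO bO hgc gk (exists_barrier hG Gk).
exists u; split => //.
  exists k; split => [|m km x _]; first exact: num_real.
  have /andP[h1 h2] := gu x.
  rewrite /= ler_norml (le_trans h2 (ltW km)) andbT (le_trans _ h1)//.
  have := hG x; rewrite ler_norml => /andP[+ _]; apply: le_trans.
  by rewrite lerN2 (le_trans Gk (ltW km)).
move=> phi x hphi Ox touch.
have /andP[_] := gu x; rewrite le_eqVlt => /predU1P[uk|uk]; last exact: hu.
rewrite uk; apply: supersolution_max => // y.
have := touch y; have /andP[_] := gu y; rewrite uk; lra.
Qed.

End supersolution.

(** * From inequalities for all pairs to viscosity solutions *)

Section viscosity_of_continuous.
Context (R : realType) (n : nat).

Lemma continuous_lower_semicontinuous (u : 'rV[R]_n -> R) : (0 < n)%N ->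
  continuous u -> lower_semicontinuous (EFin \o u).
Proof.
move=> n0 cu x a; rewrite lte_fin => ax.
have ux0 : 0 < u x - a by rewrite subr_gt0.
have [d d0 h] := (continuous_enormP u x n0).1 (cu x) _ ux0.
exists (eball x d); first exact: nbhs_eball.
move=> y /h; rewrite ltr_norml /= lte_fin => /andP[+ _].
by rewrite opprB ltrBDr addrNK.
Qed.

Context (sigma : R) (A B : Type) (K : A -> B -> 'rV[R]_n -> 'rV[R]_n -> R).
Context (bb : A -> B -> 'rV[R]_n -> 'rV[R]_n) (c f : A -> B -> 'rV[R]_n -> R).

(** A single index [a] bounds the supremum from below; over an empty [A] it would be -oo. *)
Lemma isaacs_ge0 x (v : R) phi : inhabited A ->
  classical_ge0 sigma K bb c f x v phi -> (0 <= isaacs sigma K bb c f x v phi)%E.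
Proof.
move=> [a] h; apply: (@le_trans _ _ (ereal_inf
    [set (- nonlocal_op sigma (K a b) x phi + dotmul (bb a b x) (grad phi x)
          + c a b x * v + f a b x)%:E | b in [set: B]])).
  by apply: le_ereal_inf_tmp => _ [b _ <-]; rewrite lee_fin; exact: h.
by apply: ereal_sup_ubound; exists a.
Qed.

Lemma nonlocal_opN Lam a b x phi : (0 < n)%N -> 0 < sigma < 2 ->
  kernel_upper_bounds sigma Lam (K a b x) -> Cb2 phi ->
  nonlocal_op sigma (K a b) x (fun y => - phi y) = - nonlocal_op sigma (K a b) x phi.
Proof.
move=> n0 hs hK hphi; rewrite -mulN1r /nonlocal_op -RintegralZl//; last first.
  exact: (integrable_delta n0 hs hK).
congr Rintegral; apply/funext => z; rewrite !deltaE grad_oppr; last first.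
  by move=> i; exact: (hphi.2 i).1.
by rewrite dotmulNl; ring.
Qed.

(** Dually, one index [b] bounds every infimum from above; over an empty [B] it would be +oo. *)
Lemma isaacs_le0 x (v : R) phi : inhabited B ->
  (forall a b, - nonlocal_op sigma (K a b) x phi + dotmul (bb a b x) (grad phi x)
     + c a b x * v + f a b x <= 0) ->
  (isaacs sigma K bb c f x v phi <= 0)%E.
Proof.
move=> [b] h; apply: ge_ereal_sup => _ [a _ <-].
apply: ereal_inf_le; eexists; first by exists b.
by rewrite lee_fin; exact: h.
Qed.

End viscosity_of_continuous.

Theorem theorem5p12 (R : realType) (n : nat) (hn : (0 < n)%N)
  (A B : Type) (hA : inhabited A) (hB : inhabited B)
  (Omega : set 'rV[R]_n) (hOmega : bounded_domain Omega)
  (rO : R) (yb : 'rV[R]_n -> R -> 'rV[R]_n)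
  (hball : uniform_exterior_ball Omega rO yb)
  (sigma : R) (hsigma : 0 < sigma < 2)
  (K : A -> B -> 'rV[R]_n -> 'rV[R]_n -> R)
  (bb : A -> B -> 'rV[R]_n -> 'rV[R]_n)
  (c f : A -> B -> 'rV[R]_n -> R)
  (hbb0 : sigma < 1 -> forall a b x, Omega x -> bb a b x = 0)
  (gamma : R) (hgamma : 0 < gamma)
  (hcgamma : forall a b x, Omega x -> gamma <= c a b x)
  (g : 'rV[R]_n -> R) (hgb : [bounded g x | x in [set: 'rV[R]_n]])
  (hgc : continuous g)
  (hbbb : equi_bounded (@enorm R n) Omega (fun i : A * B => bb i.1 i.2))
  (hbbc : equi_unif_continuous (@enorm R n) Omega
            (fun i : A * B => bb i.1 i.2))
  (hcb : equi_bounded Num.norm Omega (fun i : A * B => c i.1 i.2))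
  (hcc : equi_unif_continuous Num.norm Omega (fun i : A * B => c i.1 i.2))
  (hfb : equi_bounded Num.norm Omega (fun i : A * B => f i.1 i.2))
  (hfc : equi_unif_continuous Num.norm Omega (fun i : A * B => f i.1 i.2))
  (hKc : equi_unif_continuous Num.norm Omega
           (fun (i : A * B * {z : 'rV[R]_n | z != 0}) x =>
              K i.1.1 i.1.2 x (sval i.2)))
  (hKb : forall z : 'rV[R]_n, z != 0 ->
           equi_bounded Num.norm Omega
             (fun (i : A * B) x => K i.1 i.2 x z))
  (Lam : R)
  (hKup : forall a b x, Omega x -> kernel_upper_bounds sigma Lam (K a b x))
  (hKnd : boundary_nondegenerate sigma K Omega rO yb) :
  exists ubar uunder : 'rV[R]_n -> R,
    [/\ continuous ubar,
        dirichlet_supersolution Omega (isaacs sigma K bb c f) g ubar,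
        continuous uunder,
        dirichlet_subsolution Omega (isaacs sigma K bb c f) g uunder &
        forall x, ~ Omega x -> ubar x = g x /\ uunder x = g x].
Proof.
have [ubar [cubar bubar ubarO tubar]] := @exists_supersolution R n hn A B
  Omega hOmega rO yb hball sigma hsigma K bb c f hbb0 gamma hgamma hcgamma g hgb hgc
  hbbb hcb hfb Lam hKup hKnd.
have hgb' : [bounded - g x | x in [set: 'rV[R]_n]].
  have [M [Mr hM]] := hgb; exists M; split => // m /hM h x hx.
  by rewrite /= normrN; exact: h.
have hgc' : continuous (fun x => - g x).
  by move=> x; apply: continuousN; exact: hgc.
have hfb' : equi_bounded Num.norm Omega (fun (i : A * B) x => - f i.1 i.2 x).
  have [M hM] := hfb; exists M => i x Ox.
  by rewrite normrN; exact: hM.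
have [v [cv bv vO tv]] := @exists_supersolution R n hn A B
  Omega hOmega rO yb hball sigma hsigma K bb c (fun a b x => - f a b x) hbb0 gamma
  hgamma hcgamma (fun x => - g x) hgb' hgc' hbbb hcb hfb' Lam hKup hKnd.
exists ubar, (fun x => - v x); split => //.
- split; last by move=> x /ubarO ->.
  split => //; first exact: continuous_lower_semicontinuous.
  move=> phi x hphi Ox touch; apply: isaacs_ge0 => //; exact: tubar.
- by move=> x; apply: continuousN; exact: cv.
- split; last by move=> x /vO ->; rewrite opprK.
  split.
  + have [M [Mr hM]] := bv; exists M; split => // m /hM h x hx.
    by rewrite /= normrN; exact: h.
  + rewrite /upper_semicontinuous (_ : (fun x => _) = EFin \o v).
      exact: continuous_lower_semicontinuous.
    by apply/funext => x; rewrite /= opprK.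
  move=> phi x hphi Ox touch; apply: isaacs_le0 => // a b.
  have touch' y : v x - - phi x <= v y - - phi y by have := touch y; lra.
  (* The operator is linear for a fixed pair, so the inequality for [- phi], [v] and [- f] is the
     negative of the one wanted. *)
  have := tv _ x (Cb2_opp hphi) Ox touch' a b.
  rewrite (nonlocal_opN hn hsigma (hKup a b x Ox) hphi) grad_oppr; last first.
    by move=> i; exact: (hphi.2 i).1.
  by rewrite dotmulNr mulrN; lra.
by move=> x nOx; rewrite ubarO// vO// opprK.
Qed.
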